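(* Let $k$ be an odd integer, $L>0$, $s\in(0,\pi)$, and $x=L\cot(s)$ (equivalently $s=\operatorname{arccot}(x/L)$, with $\operatorname{arccot}$ taking values in $(0,\pi)$). Let $(-\Delta)_s^{1/2}e^{iks}$ denote the half Laplacian of the function $x\mapsto e^{ik\operatorname{arccot}(x/L)}$ on $\mathbb R$, evaluated at the point $x=L\cot(s)$. Then $$(-\Delta)_s^{1/2}e^{iks} = -\frac{2i}{L\pi (k+2)} - \frac{k}{L}\sin^2(s)e^{iks} + \frac{8i\,{}_2F_1(1,-k/2-1;-k/2+2;e^{i2s})}{L\pi (4-k^2)},$$ or, equivalently, $$(-\Delta)_s^{1/2}e^{iks} = -\frac{2i\operatorname{sgn}(k)}{L\pi (|k|+2)} - \frac{2ik}{L\pi}e^{iks}\left[\cos(s) + \sin^2(s)\ln\left(\cot\left(\frac s2\right)\right) + \sum_{n=0}^{(|k|-1)/2}\frac{4e^{-i\operatorname{sgn}(k)(2n+1)s}}{(2n-1)(2n+1)(2n+3)}\right].$$ Furthermore, when $L=1$, these identities are expressed in terms of $x\in\mathbb R$ as $$(-\Delta)^{1/2} \frac{(x + i)^k}{(1+x^2)^{k/2}} = -\frac{2i}{\pi (k+2)} - \frac{k(x + i)^k}{(1+x^2)^{k/2+1}} + \frac{8i}{\pi (4-k^2)}\,{}_2F_1\left(1,-k/2-1;-k/2+2; \frac{(x+i)^2}{1+x^2} \right)$$ and $$(-\Delta)^{1/2} \frac{(x + i)^k}{(1+x^2)^{k/2}} = -\frac{2i\operatorname{sgn}(k)}{\pi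 (|k|+2)} - \frac{2ik(x + i)^k\left[x(1+x^2)^{1/2} + \operatorname{arcsinh}(x)\right]}{\pi(1+x^2)^{k/2+1}} - \sum_{n=0}^{(|k|-1)/2}\frac{8ik(x + i)^{k-\operatorname{sgn}(k)(2n+1)}}{\pi(2n-1)(2n+1)(2n+3)(1+x^2)^{[k-\operatorname{sgn}(k)(2n+1)]/2}}.$$
   Context: For a bounded twice continuously differentiable function $u:\mathbb R\to\mathbb C$ (with bounded derivatives up to order two), the half Laplacian is $$(-\Delta)^{1/2}u(x) = \frac{1}{\pi}\int_{-\infty}^\infty\frac{u(x)-u(x+y)}{y^2}\,dy,$$ where the integral is understood in the principal value sense; equivalently, $(-\Delta)^{1/2}u(x)=\frac1\pi\int_{-\infty}^{\infty}\frac{u'(y)}{x-y}\,dy$ (principal value). Under the change of variable $x=L\cot(s)$, $L>0$, $s\in(0,\pi)$, one writes $U(s)=u(x(s))$ and $(-\Delta)_s^{1/2}U(s) := (-\Delta)^{1/2}u(x)$ with $x = L\cot(s)$. For $L=1$, $e^{iks}=(x+i)^k/(1+x^2)^{k/2}$. The Gaussian hypergeometric function is ${}_2F_1(a,b;c;z)=\sum_{n=0}^\infty \frac{(a)_n(b)_n}{(c)_n}\frac{z^n}{n!}$ with $(z)_n=z(z+1)\cdots(z+n-1)$, $(z)_0=1$; for the parameters used here $c-a-b=2>0$, so the series converges absolutely for $|z|=1$. $\operatorname{sgn}$ is the sign function. *)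

(* Defs.v *)
From Stdlib Require Import Reals ZArith Lra.
From Coquelicot Require Export Coquelicot.

Open Scope R_scope.

(* e^(i t) for real t. *)
Definition expi (t : R) : C := (cos t, sin t).

Definition cot (s : R) : R := cos s / sin s.

(* The branch with values in (0, PI); see arccot_spec. *)
Definition arccot (x : R) : R := PI / 2 - atan x.

Lemma arccot_spec (x : R) : 0 < arccot x < PI /\ cot (arccot x) = x.
Proof.
unfold arccot, cot.
destruct (atan_bound x) as [h1 h2].
split; [lra|].
rewrite cos_shift, sin_shift.
exact (tan_atan x).
Qed.

Definition Cpow_Z (z : C) (k : Z) : C :=
  match k with
  | Z0 => 1%C
  | Zpos p => Cpow z (Pos.to_nat p)
  | Zneg p => Cinv (Cpow z (Pos.to_nat p))
  end.

(* The rising factorial. *)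
Fixpoint pochhammer (a : C) (n : nat) : C :=
  match n with
  | O => 1%C
  | S m => (pochhammer a m * (a + INR m))%C
  end.

Definition hyp2F1_term (a b c z : C) (n : nat) : C :=
  (pochhammer a n * pochhammer b n / pochhammer c n * (z ^ n / INR (fact n)))%C.

(* The sum of the Gauss series in C; arbitrary where the series diverges. *)
Definition hyp2F1 (a b c z : C) : C :=
  iota (T := C_CompleteNormedModule)
    (fun l : C => is_series (V := C_NormedModule) (hyp2F1_term a b c z) l).

(* The integral of f over the real line, with principal value at 0, exists and
   equals l.  Il eps and Ir eps are the integrals over (-oo, -eps] and
   [eps, +oo), which are required to converge separately. *)
Definition is_pv_RInt (f : R -> C) (l : C) : Prop :=
  exists Il Ir : R -> C,
    (forall eps : R, 0 < eps ->
       is_RInt_gen (V := C_R_NormedModule) f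
         (Rbar_locally m_infty) (at_point (- eps)) (Il eps) /\
       is_RInt_gen (V := C_R_NormedModule) f
         (at_point eps) (Rbar_locally p_infty) (Ir eps)) /\
    filterlim (fun eps : R => (Il eps + Ir eps)%C) (at_right 0) (locally l).

(* (-Delta)^(1/2) u exists at x and equals l. *)
Definition is_half_laplacian (u : R -> C) (x : R) (l : C) : Prop :=
  exists v : C,
    is_pv_RInt (fun y : R => ((u x - u (x + y)%R) / (y ^ 2)%R)%C) v /\
    l = (1 / PI * v)%C.

(* The same operator in the variable s, where x = L cot s: U corresponds to
   the function u on R with U(s) = u(L cot s), that is u(x) = U(arccot(x/L)). *)
Definition is_half_laplacian_s (L : R) (U : R -> C) (s : R) (l : C) : Prop :=
  is_half_laplacian (fun x : R => U (arccot (x / L))) (L * cot s) l.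

(* This is e^(i k arccot x), written algebraically. *)
Definition cayley_pow (k : Z) (x : R) : C :=
  (Cpow_Z (x + Ci) k / Rpower (1 + x ^ 2) (IZR k / 2))%C.

Lemma is_half_laplacian_unique (u : R -> C) (x : R) (l1 l2 : C) :
  is_half_laplacian u x l1 -> is_half_laplacian u x l2 -> l1 = l2.
Proof.
intros [v1 [[Il1 [Ir1 [h1 c1]]] ->]] [v2 [[Il2 [Ir2 [h2 c2]]] ->]].
f_equal.
apply (filterlim_locally_unique (V := C_R_NormedModule) (F := at_right 0)
         (fun eps : R => (Il1 eps + Ir1 eps)%C)); [exact c1|].
refine (filterlim_ext_loc _ _ _ c2).
exists (mkposreal 1 Rlt_0_1); intros eps _ heps.
destruct (h1 eps heps) as [a1 b1].
destruct (h2 eps heps) as [a2 b2].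
rewrite <- (is_RInt_gen_unique (V := C_R_CompleteNormedModule) _ _ a1).
rewrite <- (is_RInt_gen_unique (V := C_R_CompleteNormedModule) _ _ a2).
rewrite <- (is_RInt_gen_unique (V := C_R_CompleteNormedModule) _ _ b1).
rewrite <- (is_RInt_gen_unique (V := C_R_CompleteNormedModule) _ _ b2).
reflexivity.
Qed.

(* Main.v *)
(* With x = L cot s and x + y = L cot t, integration by parts turns the kernel
   1/y^2 into i k e^(ikt) sin t / sin (s - t), up to constants.  Since k is odd,
   e^(ikt) sin t - e^(iks) sin s is divisible by sin (s - t) among trigonometric
   polynomials; the remaining multiple of 1 / sin (s - t) integrates to
   ln |tan ((s - t) / 2)|, whose singularity at t = s cancels in the principal
   value.  Hence the half Laplacian is determined by q = Q(PI) - Q(0), where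
   Q'(t) sin (s - t) = e^(ikt) sin t - e^(iks) sin s, and q obeys a two-step
   recurrence in k.  Both closed forms satisfy this recurrence: the finite sum by
   a telescoping computation, the hypergeometric one because its partial
   fractions are three sums of z^n / (2 n + m) with z = e^(2is), which are
   shifts of the artanh series at e^(is). *)
Require Import Defs.
From Stdlib Require Import Reals ZArith Lra Lia FunctionalExtensionality.
From Coquelicot Require Import Coquelicot.
Open Scope R_scope.

(** * Calculus of complex functions of a real variable *)

(** No integral is evaluated directly. An explicit primitive of the difference quotient on y <> 0
    reduces the principal value to the limits of that primitive at both infinities and on the two
    sides of 0. The recurrence starts at K = 1, where Q is a multiple of e^(it). Its step can be
    inverted when K and K + 2 are nonzero, so the series form reaches every odd integer from 1 in
    both directions; the finite form only climbs, and conjugation supplies negative k. The delicate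
    point is convergence: z = e^(2is) lies on the unit circle, and partial fractions split an
    absolutely convergent series into three that converge only conditionally. A remainder bound on 0
    <= r <= 1, uniform up to r = 1 because sin s <> 0, settles this. The value artanh (e^(is)) = ln
    (cot (s/2)) / 2 + i PI / 4 accounts for the difference between the two forms: its logarithm
    cancels the one produced by the kernel, and its constant i PI / 4 leaves the term -(k/L)
    sin^2(s) e^(iks). *)

Definition is_deriv (f : R -> C) (x : R) (l : C) : Prop :=
  @is_derive R_AbsRing C_R_NormedModule f x l.

Lemma is_deriv_pair (f : R -> C) (x : R) (l : C) :
  is_derive (fun t => fst (f t)) x (fst l) ->
  is_derive (fun t => snd (f t)) x (snd l) -> is_deriv f x l.
Proof.
intros h1 h2.
assert (E : forall z : C, @plus C_R_NormedModule (scal (fst z) (1, 0)) (scal (snd z) (0, 1)) = z).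
{ intros [a b]; apply injective_projections; cbn; ring. }
rewrite <- (E l).
apply (is_derive_ext (V := C_R_NormedModule)
  (fun t => plus (scal (fst (f t)) ((1, 0) : C)) (scal (snd (f t)) ((0, 1) : C)))); [intros t; apply E|].
apply (is_derive_plus (V := C_R_NormedModule)); apply (is_derive_scal_l (V := C_R_NormedModule)); assumption.
Qed.

Lemma is_deriv_fst (f : R -> C) (x : R) (l : C) :
  is_deriv f x l -> is_derive (fun t => fst (f t)) x (fst l).
Proof.
intros h.
apply (filterdiff_comp' f fst x (fun y => scal y l) fst h).
apply filterdiff_linear, is_linear_fst.
Qed.

Lemma is_deriv_snd (f : R -> C) (x : R) (l : C) :
  is_deriv f x l -> is_derive (fun t => snd (f t)) x (snd l).
Proof.
intros h.
apply (filterdiff_comp' f snd x (fun y => scal y l) snd h).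
apply filterdiff_linear, is_linear_snd.
Qed.

Lemma is_deriv_eq (f : R -> C) (x : R) (l l' : C) :
  is_deriv f x l -> l = l' -> is_deriv f x l'.
Proof. now intros h <-. Qed.

Lemma is_deriv_mult (f g : R -> C) (x : R) (df dg : C) :
  is_deriv f x df -> is_deriv g x dg ->
  is_deriv (fun t => f t * g t)%C x (df * g x + f x * dg)%C.
Proof.
intros hf hg.
pose proof (is_deriv_fst _ _ _ hf) as f1. pose proof (is_deriv_snd _ _ _ hf) as f2.
pose proof (is_deriv_fst _ _ _ hg) as g1. pose proof (is_deriv_snd _ _ _ hg) as g2.
apply is_deriv_pair; cbn.
- replace (_ + _) with
    ((fst df * fst (g x) + fst (f x) * fst dg) - (snd df * snd (g x) + snd (f x) * snd dg)) by ring.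
  apply (is_derive_minus (V := R_NormedModule)); apply (is_derive_mult (K := R_AbsRing)); auto using Rmult_comm.
- replace (_ + _) with
    ((fst df * snd (g x) + fst (f x) * snd dg) + (snd df * fst (g x) + snd (f x) * fst dg)) by ring.
  apply (is_derive_plus (V := R_NormedModule)); apply (is_derive_mult (K := R_AbsRing)); auto using Rmult_comm.
Qed.

Lemma is_deriv_plus (f g : R -> C) (x : R) (df dg : C) :
  is_deriv f x df -> is_deriv g x dg ->
  is_deriv (fun t => f t + g t)%C x (df + dg)%C.
Proof. exact (is_derive_plus (V := C_R_NormedModule) f g x df dg). Qed.

Lemma is_deriv_minus (f g : R -> C) (x : R) (df dg : C) :
  is_deriv f x df -> is_deriv g x dg ->
  is_deriv (fun t => f t - g t)%C x (df - dg)%C.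
Proof. exact (is_derive_minus (V := C_R_NormedModule) f g x df dg). Qed.

Lemma is_deriv_const (c : C) (x : R) : is_deriv (fun _ => c) x 0%C.
Proof. exact (is_derive_const (V := C_R_NormedModule) c x). Qed.

Lemma is_deriv_RtoC (f : R -> R) (x l : R) :
  is_derive f x l -> is_deriv (fun t => RtoC (f t)) x (RtoC l).
Proof.
intros h; apply is_deriv_pair; cbn; [exact h|].
apply (is_derive_const (V := R_NormedModule)).
Qed.

Lemma is_deriv_cmult (c : C) (f : R -> C) (x : R) (l : C) :
  is_deriv f x l -> is_deriv (fun t => c * f t)%C x (c * l)%C.
Proof.
intros h.
eapply is_deriv_eq; [apply is_deriv_mult; [apply is_deriv_const | exact h]|].
cbv beta; ring.
Qed.

Lemma is_deriv_comp (f : R -> C) (g : R -> R) (x dg : R) (df : C) :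
  is_deriv f (g x) df -> is_derive g x dg ->
  is_deriv (fun t => f (g t)) x (df * dg)%C.
Proof.
intros hf hg.
eapply is_deriv_eq; [exact (is_derive_comp (V := C_R_NormedModule) f g x df dg hf hg)|].
apply injective_projections; cbn; ring.
Qed.

Lemma is_deriv_expi (a t : R) :
  is_deriv (fun t => expi (a * t)) t (Ci * a * expi (a * t))%C.
Proof.
apply is_deriv_pair; cbn; auto_derive; trivial; ring.
Qed.

Lemma is_deriv_continuous (f : R -> C) (x : R) (l : C) :
  is_deriv f x l -> continuous (U := C_UniformSpace) f x.
Proof.
intros h. apply (ex_derive_continuous (V := C_R_NormedModule)). now exists l.
Qed.

Lemma filterlim_Cplus {T : Type} {F : (T -> Prop) -> Prop} {FF : Filter F}
  (f g : T -> C) (a b : C) :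
  filterlim f F (locally a) -> filterlim g F (locally b) ->
  filterlim (fun t => f t + g t)%C F (locally (a + b)%C).
Proof.
intros hf hg.
exact (filterlim_comp_2 _ _ _ hf hg (filterlim_plus (V := C_R_NormedModule) a b)).
Qed.

Lemma filterlim_Ccmult {T : Type} {F : (T -> Prop) -> Prop} {FF : Filter F}
  (c : C) (f : T -> C) (a : C) :
  filterlim f F (locally a) ->
  filterlim (fun t => c * f t)%C F (locally (c * a)%C).
Proof.
intros hf.
exact (filterlim_comp _ _ _ _ _ _ _ _ hf (filterlim_scal_r (V := C_NormedModule) c a)).
Qed.

Lemma filterlim_C {T : Type} {F : (T -> Prop) -> Prop} {FF : Filter F}
  (f : T -> C) (l : C) :
  filterlim (fun t => fst (f t)) F (locally (fst l)) ->
  filterlim (fun t => snd (f t)) F (locally (snd l)) ->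
  filterlim f F (locally l).
Proof.
intros h1 h2.
apply (filterlim_locally (U := C_UniformSpace)); intros eps.
generalize (proj1 (filterlim_locally _ _) h1 eps) (proj1 (filterlim_locally _ _) h2 eps).
intros e1 e2. generalize (filter_and _ _ e1 e2). apply filter_imp.
intros t [a b]; split; assumption.
Qed.

(** [F] may be singular at 0, since only the difference [F (- eps) - F eps] has to converge. The
    one-sided integrals are [F (- eps) - a] and [b - F eps], and they add up to b - a plus that
    difference. *)
Lemma is_pv_RInt_primitive (f F : R -> C) (a b l : C) :
  (forall y, y <> 0 -> is_deriv F y (f y)) ->
  (forall y, y <> 0 -> continuous (U := C_UniformSpace) f y) ->
  filterlim F (Rbar_locally m_infty) (locally a) ->
  filterlim F (Rbar_locally p_infty) (locally b) ->
  filterlim (fun eps : R => F (- eps)%R - F eps)%C (at_right 0) (locally l) ->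
  is_pv_RInt f (b - a + l)%C.
Proof.
intros hF hf ha hb hl.
exists (fun eps : R => F (- eps)%R - a)%C, (fun eps : R => b - F eps)%C; split.
- intros eps he; split.
  + intros P HP.
    unfold filtermapi.
    assert (H : filterlim (fun y => F (- eps)%R - F y)%C (Rbar_locally m_infty) (locally (F (- eps)%R - a)%C)).
    { apply (filterlim_ext (fun y => F (- eps)%R + (RtoC (-1)) * F y)%C); [intros; ring|].
      replace (F (- eps)%R - a)%C with (F (- eps)%R + (RtoC (-1)) * a)%C by ring.
      apply filterlim_Cplus; [apply filterlim_const | now apply filterlim_Ccmult]. }
    apply Filter_prod with (Q := fun y => P (F (- eps)%R - F y)%C /\ y < - eps) (R := fun y => y = - eps).
    * apply filter_and; [exact (H P HP) | exists (- eps); auto].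
    * reflexivity.
    * intros y z [h1 h2] ->. exists (F (- eps)%R - F y)%C; split; [|exact h1].
      cbn.
      apply (is_RInt_derive (V := C_R_CompleteNormedModule) F f);
        intros t ht; rewrite Rmin_left, Rmax_right in ht by lra; [apply hF | apply hf]; lra.
  + intros P HP.
    unfold filtermapi.
    assert (H : filterlim (fun y => F y - F eps)%C (Rbar_locally p_infty) (locally (b - F eps)%C)).
    { apply filterlim_Cplus; [exact hb | apply filterlim_const]. }
    apply Filter_prod with (Q := fun y => y = eps) (R := fun y => P (F y - F eps)%C /\ eps < y).
    * reflexivity.
    * apply filter_and; [exact (H P HP) | exists eps; auto].
    * intros y z -> [h1 h2]. exists (F z - F eps)%C; split; [|exact h1].
      cbn.
      apply (is_RInt_derive (V := C_R_CompleteNormedModule) F f);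
        intros t ht; rewrite Rmin_left, Rmax_right in ht by lra; [apply hF | apply hf]; lra.
- apply (filterlim_ext (fun eps : R => (b - a) + (F (- eps)%R - F eps))%C); [intros; ring|].
  apply filterlim_Cplus; [apply filterlim_const | exact hl].
Qed.

(** * The change of variable *)

Lemma arccot_cot (s : R) : 0 < s < PI -> arccot (cot s) = s.
Proof.
intros hs. unfold arccot, cot.
replace (cos s / sin s) with (tan (PI / 2 - s)) by (unfold tan; now rewrite sin_shift, cos_shift).
rewrite atan_tan; lra.
Qed.

Lemma arccot_decreasing (a b : R) : a < b -> arccot b < arccot a.
Proof. intros h. unfold arccot. pose proof (atan_increasing _ _ h); lra. Qed.

Lemma arccot_opp (a : R) : arccot (- a) = PI - arccot a.
Proof. unfold arccot. rewrite atan_opp; lra. Qed.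

Lemma sin_arccot_pos (a : R) : 0 < sin (arccot a).
Proof. apply sin_gt_0; apply arccot_spec. Qed.

(** The derivative -1 / (1 + a^2) is rewritten by 1 + cot^2 = 1 / sin^2, which keeps later
    computations trigonometric in the new variable. *)
Lemma is_derive_arccot (a : R) : is_derive arccot a (- sin (arccot a) ^ 2).
Proof.
pose proof (sin_arccot_pos a) as hs.
pose proof (sin2_cos2 (arccot a)) as h1; unfold Rsqr in h1.
assert (E : - sin (arccot a) ^ 2 = 0 - / (1 + a²)).
{ rewrite <- (proj2 (arccot_spec a)) at 2. unfold cot, Rsqr.
  set (S := sin (arccot a)) in *. set (D := cos (arccot a)) in *.
  replace (1 + D / S * (D / S)) with ((S * S + D * D) / (S * S)) by (field; lra).
  rewrite h1. field; lra. }
rewrite E.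
apply (is_derive_minus (V := R_NormedModule) (fun _ => PI / 2) atan).
- apply (is_derive_const (V := R_NormedModule)).
- apply is_derive_atan.
Qed.

Lemma filterlim_arccot_p : filterlim arccot (Rbar_locally p_infty) (locally 0).
Proof.
apply filterlim_locally; intros eps.
(* The cap 1 < PI keeps [e] where [arccot_cot] applies, so that [cot e] serves as the threshold. *)
pose (e := Rmin eps 1).
assert (he : 0 < e <= 1) by (split; [apply Rmin_glb_lt; [apply cond_pos | lra] | apply Rmin_r]).
pose proof PI2_1.
exists (cot e); intros y hy.
pose proof (arccot_decreasing _ _ hy) as h1.
rewrite arccot_cot in h1 by lra.
pose proof (arccot_spec y) as [h2 _].
change (Rabs (arccot y - 0) < eps).
pose proof (Rmin_l eps 1 : e <= eps).
apply Rabs_def1; lra.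
Qed.

Lemma filterlim_arccot_m : filterlim arccot (Rbar_locally m_infty) (locally PI).
Proof.
assert (H : filterlim (fun y => PI + - arccot (- y)) (Rbar_locally m_infty) (locally (PI + - 0))).
{ eapply (filterlim_comp_2 (fun _ => PI) (fun y => - arccot (- y)));
    [apply filterlim_const | | exact (filterlim_plus (V := R_NormedModule) PI (- 0))].
  eapply filterlim_comp; [|apply (filterlim_opp (V := R_NormedModule))].
  eapply filterlim_comp; [apply (filterlim_Rbar_opp m_infty) | exact filterlim_arccot_p]. }
replace (PI + - 0) with PI in H by ring.
revert H; apply filterlim_ext; intros y; rewrite arccot_opp; ring.
Qed.

Lemma sin_minus_neq_0 (s t : R) : - PI < s - t < PI -> s <> t -> sin (s - t) <> 0.
Proof.
intros h1 h2.
destruct (Rtotal_order s t) as [h | [h | h]]; [|lra|].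
- pose proof (sin_gt_0 (t - s)). replace (s - t) with (- (t - s)) by ring.
  rewrite sin_neg. lra.
- pose proof (sin_gt_0 (s - t)). lra.
Qed.

(** The quotient is tan^2 ((s - t) / 2), so the function is ln |tan ((s - t) / 2)|. Writing it as
    half the logarithm of a square gives one formula on both sides of s, without an absolute
    value. *)
Lemma is_derive_ln_tan_half (s t : R) :
  - PI < s - t < PI -> s <> t ->
  is_derive (fun t => ln ((1 - cos (s - t)) / (1 + cos (s - t))) / 2) t (- / sin (s - t)).
Proof.
intros h1 h2.
assert (hs := sin_minus_neq_0 s t h1 h2).
pose proof (sin2_cos2 (s - t)) as h3. unfold Rsqr in h3.
pose proof (COS_bound (s - t)).
assert (0 < sin (s - t) * sin (s - t)) by nra.
assert (0 < 1 + cos (s - t)) by nra.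
assert (0 < 1 - cos (s - t)) by nra.
auto_derive.
- repeat split; unfold Rminus in *; try lra.
  now apply Rdiv_lt_0_compat.
- change (s + - t) with (s - t).
  set (D := cos (s - t)) in *. set (S := sin (s - t)) in *.
  field_simplify_eq; [|repeat split; lra].
  replace (1 + - D) with (1 - D) by ring.
  nra.
Qed.

Lemma filterlim_diffq (h : R -> R) (d : R) :
  is_derive h 0 d -> filterlim (fun e => (h e - h 0) / e) (at_right 0) (locally d).
Proof.
intros H. apply is_derive_Reals in H.
apply filterlim_locally; intros eps.
destruct (H eps (cond_pos eps)) as [del hd].
exists del; intros y hy h0.
change (Rabs (y - 0) < del) in hy. change (Rabs ((h y - h 0) / y - d) < eps).
rewrite <- (Rplus_0_l y) at 1. apply hd; [lra|]. now rewrite Rminus_0_r in hy.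
Qed.

(** The left and right difference quotients have the same limit d, so a first derivative at 0 is
    enough. *)
Lemma filterlim_second_diffq (h : R -> R) (d : R) :
  is_derive h 0 d ->
  filterlim (fun e => (h (- e) - h 0) / (- e) - (h e - h 0) / e) (at_right 0) (locally 0).
Proof.
intros H.
assert (H' : is_derive (fun e => h (- e)) 0 (- d)).
{ replace (- d) with (scal (-1) d) by (cbn; unfold mult; cbn; ring).
  apply (is_derive_comp h Ropp); [now rewrite Ropp_0 | auto_derive; trivial; ring]. }
apply filterlim_diffq in H, H'. rewrite Ropp_0 in H'.
replace (locally 0) with (locally (- (- d + d))) by (f_equal; ring).
apply (filterlim_ext_loc (fun e => - ((h (- e) - h 0) / e + (h e - h 0) / e))).
{ exists (mkposreal 1 Rlt_0_1); intros y _ hy. field. lra. }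
eapply filterlim_comp; [|apply (filterlim_opp (V := R_NormedModule))].
exact (filterlim_comp_2 _ _ _ H' H (filterlim_plus (V := R_NormedModule) (- d) d)).
Qed.

(** * The half Laplacian from a primitive of the kernel *)

Lemma RtoC_neq_0 (r : R) : r <> 0 -> RtoC r <> 0%C.
Proof. intros h e; apply h; now apply RtoC_inj. Qed.

(** The quotient by sin (s - t) is encoded by multiplying out. At t = s the equation reads 0 = 0;
    differentiability of [Q] there is what joins the two sides of s and makes [Q PI - Q 0]
    meaningful. [K] is real so that shifts by 2 need no casts. *)
Definition has_kernel_primitive (K s : R) (q : C) : Prop :=
  exists Q DQ : R -> C,
    (forall t, is_deriv Q t (DQ t)) /\
    (forall t, DQ t * sin (s - t) = expi (K * t) * sin t - expi (K * s) * sin s)%C /\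
    q = (Q PI - Q 0%R)%C.

Lemma filterlim_Cscal {T : Type} {F : (T -> Prop) -> Prop} {FF : Filter F}
  (f : T -> C) (g : T -> R) (a : C) (b : R) :
  filterlim f F (locally a) -> filterlim g F (locally b) ->
  filterlim (fun t => f t * g t)%C F (locally (a * b)%C).
Proof.
intros hf hg.
assert (E : forall (r : R) (z : C), @scal R_AbsRing C_R_NormedModule r z = (z * r)%C)
  by (intros r z; apply injective_projections; cbn; ring).
rewrite <- E.
apply (filterlim_ext (fun t => @scal R_AbsRing C_R_NormedModule (g t) (f t))); [intros t; apply E|].
exact (filterlim_comp_2 _ _ _ hg hf (filterlim_scal (V := C_R_NormedModule) b a)).
Qed.

(** This is cot t - cot s = sin (s - t) / (sin s sin t) with denominators cleared. It shows that sin
    (s - t) <> 0 when y <> 0, and it expresses 1/y through s and t. *)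
Lemma arccot_shift (L x y : R) : 0 < L ->
  y * (sin (arccot ((x + y) / L)) * sin (arccot (x / L)))
  = L * sin (arccot (x / L) - arccot ((x + y) / L)).
Proof.
intros hL.
pose proof (sin_arccot_pos (x / L)). pose proof (sin_arccot_pos ((x + y) / L)).
assert (E : y = L * (cot (arccot ((x + y) / L)) - cot (arccot (x / L)))).
{ rewrite !(fun a => proj2 (arccot_spec a)). field; lra. }
rewrite E at 1. rewrite sin_minus. unfold cot. field; lra.
Qed.

Lemma is_derive_arccot_shift (L x y : R) : 0 < L ->
  is_derive (fun y => arccot ((x + y) / L)) y (- sin (arccot ((x + y) / L)) ^ 2 / L).
Proof.
intros hL.
evar_last.
- apply (is_derive_comp arccot (fun y => (x + y) / L)).
  + apply is_derive_arccot.
  + auto_derive; [trivial|reflexivity].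
- cbn; unfold mult; cbn; field; lra.
Qed.

(** The increment of ln |tan ((s - t) / 2)| from t = 0, where it is ln (tan (s/2)), to t = PI, where
    it is ln (cot (s/2)). *)
Lemma ln_cot_half (s : R) : 0 < s < PI ->
  ln ((1 - cos (s - PI)) / (1 + cos (s - PI))) / 2 - ln ((1 - cos (s - 0)) / (1 + cos (s - 0))) / 2
  = 2 * ln (cot (s / 2)).
Proof.
intros hs.
assert (h1 : 0 < cos (s / 2)) by (apply cos_gt_0; lra).
assert (h2 : 0 < sin (s / 2)) by (apply sin_gt_0; lra).
assert (hc : 0 < cot (s / 2)) by (now apply Rdiv_lt_0_compat).
rewrite cos_minus, cos_PI, sin_PI, Rminus_0_r.
replace s with (2 * (s / 2)) at 1 2 3 4 5 6 by field. rewrite cos_2a.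
pose proof (sin2_cos2 (s / 2)) as h3; unfold Rsqr in h3.
set (S := sin (s / 2)) in *. set (D := cos (s / 2)) in *.
replace (1 - ((D * D - S * S) * -1 + sin (2 * (s / 2)) * 0)) with (2 * (D * D)) by nra.
replace (1 + ((D * D - S * S) * -1 + sin (2 * (s / 2)) * 0)) with (2 * (S * S)) by nra.
replace (1 - (D * D - S * S)) with (2 * (S * S)) by nra.
replace (1 + (D * D - S * S)) with (2 * (D * D)) by nra.
replace (2 * (D * D) / (2 * (S * S))) with (cot (s / 2) * cot (s / 2))
  by (unfold cot; fold S D; field; lra).
replace (2 * (S * S) / (2 * (D * D))) with (/ (cot (s / 2) * cot (s / 2)))
  by (unfold cot; fold S D; field; lra).
rewrite ln_Rinv by nra. rewrite ln_mult by lra. field.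
Qed.

(* The logarithm splits into an even function of y, which cancels in the principal
   value, and a function of t that is smooth at t = s. *)
Lemma ln_tan_half_shift (L x y : R) : 0 < L -> y <> 0 ->
  let s := arccot (x / L) in let t := arccot ((x + y) / L) in
  ln ((1 - cos (s - t)) / (1 + cos (s - t))) / 2
  = ln (y ^ 2) / 2 + ln (sin t * sin s / (L * (1 + cos (s - t)))).
Proof.
intros hL hy s t.
pose proof (arccot_shift L x y hL) as h. fold s t in h.
pose proof (sin_arccot_pos (x / L)) as hs. fold s in hs.
pose proof (sin_arccot_pos ((x + y) / L)) as ht. fold t in ht.
assert (hw : sin (s - t) <> 0).
{ intros e. rewrite e, Rmult_0_r in h.
  apply Rmult_integral in h. destruct h as [|h]; [easy|]. nra. }
pose proof (sin2_cos2 (s - t)) as h3. unfold Rsqr in h3.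
pose proof (COS_bound (s - t)).
assert (0 < sin (s - t) * sin (s - t)) by nra.
assert (0 < 1 + cos (s - t)) by nra.
set (D := cos (s - t)) in *. set (W := sin (s - t)) in *.
set (r := sin t * sin s / (L * (1 + D))).
assert (0 < r) by (apply Rdiv_lt_0_compat; nra).
assert (0 < y ^ 2) by nra.
replace ((1 - D) / (1 + D)) with (y ^ 2 * (r * r)).
- rewrite !ln_mult by nra. field.
- unfold r.
  replace (_ * _) with ((y * (sin t * sin s)) ^ 2 / (L ^ 2 * (1 + D) ^ 2)) by (field; lra).
  rewrite h. replace ((L * W) ^ 2) with (L ^ 2 * (W * W)) by ring.
  replace (W * W) with ((1 - D) * (1 + D)) by lra. field; lra.
Qed.

(* Here a = e^(iKs), b = e^(iKt), S = sin s, T = sin t, W = sin (s - t), D = Q'(t). *)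
Lemma primitive_deriv_algebra (a b K L S T W y D : C) :
  L <> 0%C -> S <> 0%C -> T <> 0%C -> W <> 0%C -> y <> 0%C ->
  (y * (T * S) = L * W)%C -> (D * W = b * T - a * S)%C ->
  (Ci * K * b * (- (T * T) / L) * / y + (b - a) * - / (y * y)
   + - (Ci * K * S / L) * (D * (- (T * T) / L) - a * S * (- / W * (- (T * T) / L)))
   = (a - b) / (y * y))%C.
Proof.
intros hL hS hT hW hy e1 e2.
assert (ey : (/ y = T * S / (L * W))%C).
{ rewrite <- e1. field. now repeat split. }
assert (eD : (D = (b * T - a * S) / W)%C) by (rewrite <- e2; field; easy).
rewrite eD. replace (Ci * K * b * (- (T * T) / L) * / y)%C
  with (Ci * K * b * (- (T * T) / L) * (T * S / (L * W)))%C by (now rewrite ey).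
field. now repeat split.
Qed.

Section half_laplacian.

Variables (K L x : R) (Q DQ : R -> C).
Hypothesis hL : 0 < L.
Let s := arccot (x / L).
Let t := fun y : R => arccot ((x + y) / L).
Hypothesis hQ : forall t, is_deriv Q t (DQ t).
Hypothesis hDQ : forall t,
  (DQ t * sin (s - t) = expi (K * t) * sin t - expi (K * s) * sin s)%C.

Let lam := fun t => ln ((1 - cos (s - t)) / (1 + cos (s - t))) / 2.
(** The [lam] term restores the pole subtracted in [hDQ]: since lam' = -1 / sin (s - t), the
    derivative of the second factor is e^(iKt) sin t / sin (s - t). *)
Let G := fun t : R => (- (Ci * K * sin s / L) * (Q t - expi (K * s) * sin s * lam t))%C.
(** The first summand is the boundary term of the integration by parts; [G (t y)] is a primitive of
    what remains. *)
Let F := fun y : R => ((expi (K * t y) - expi (K * s)) * (/ y)%R + G (t y))%C.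
Let f := fun y : R => ((expi (K * s) - expi (K * t y)) / (y ^ 2)%R)%C.

Let s_bound : 0 < s < PI. Proof. apply arccot_spec. Qed.
Let t_bound (y : R) : 0 < t y < PI. Proof. apply arccot_spec. Qed.

Let t_neq (y : R) : y <> 0 -> s <> t y.
Proof.
intros hy e.
pose proof (arccot_shift L x y hL) as h. fold s (t y) in h.
rewrite <- e, Rminus_diag, sin_0, Rmult_0_r in h.
pose proof (sin_gt_0 s). apply Rmult_integral in h. destruct h; [easy|nra].
Qed.

Let deriv_lam (u : R) : - PI < s - u < PI -> s <> u -> is_derive lam u (- / sin (s - u)).
Proof. apply is_derive_ln_tan_half. Qed.

Let deriv_G (u : R) : - PI < s - u < PI -> s <> u ->
  is_deriv G u (- (Ci * K * sin s / L) * (DQ u - expi (K * s) * sin s * (- / sin (s - u))%R))%C.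
Proof.
intros h1 h2.
apply is_deriv_cmult, is_deriv_minus; [apply hQ|].
apply is_deriv_cmult, is_deriv_RtoC, deriv_lam; assumption.
Qed.

Let deriv_F (y : R) : y <> 0 -> is_deriv F y (f y).
Proof.
intros hy.
pose proof (t_bound y). pose proof (t_neq y hy).
pose proof (is_derive_arccot_shift L x y hL) as ht. fold t in ht.
change (arccot ((x + y) / L)) with (t y) in ht.
assert (hi : is_derive Rinv y (- / (y * y))).
{ auto_derive; [exact hy | field; exact hy]. }
eapply is_deriv_eq.
- apply is_deriv_plus.
  + apply is_deriv_mult.
    * apply is_deriv_minus; [|apply is_deriv_const].
      apply (is_deriv_comp (fun u => expi (K * u)) t); [apply is_deriv_expi | exact ht].
    * apply is_deriv_RtoC, hi.
  + apply is_deriv_comp; [apply deriv_G; [lra | assumption] | exact ht].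
- cbv beta.
  pose proof (arccot_shift L x y hL) as h. fold s (t y) in h.
  unfold f.
  replace (y ^ 2) with (y * y) by ring.
  replace (- sin (t y) ^ 2 / L) with (- (sin (t y) * sin (t y)) / L) by (field; lra).
  assert (hw : sin (s - t y) <> 0) by (apply sin_minus_neq_0; [lra | assumption]).
  pose proof (sin_gt_0 s). pose proof (sin_gt_0 (t y)).
  rewrite (RtoC_mult y y).
  rewrite <- (primitive_deriv_algebra (expi (K * s)) (expi (K * t y)) K L (sin s) (sin (t y)) (sin (s - t y)) y (DQ (t y)));
    try (apply RtoC_neq_0; lra).
  + unfold Rdiv. rewrite ?RtoC_opp, ?RtoC_mult, ?RtoC_inv, ?RtoC_opp, ?RtoC_mult by nra.
    unfold Cminus, Cdiv. rewrite ?RtoC_mult. ring.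
  + rewrite <- !RtoC_mult. now rewrite h.
  + apply hDQ.
Qed.

Let cont_f (y : R) : y <> 0 -> continuous (U := C_UniformSpace) f y.
Proof.
intros hy.
pose proof (is_derive_arccot_shift L x y hL) as ht. fold t in ht.
eapply is_deriv_continuous.
apply is_deriv_mult.
- apply is_deriv_minus; [apply is_deriv_const|].
  apply (is_deriv_comp (fun u => expi (K * u)) t); [apply is_deriv_expi | exact ht].
- apply (is_derive_ext (V := C_R_NormedModule) (fun y : R => RtoC (/ y ^ 2))).
  (* The two functions must agree at every z; at z = 0 both inverses take the default value 0. *)
  { intros z. destruct (Req_dec z 0) as [->|hz].
    - apply injective_projections; cbn; rewrite !Rmult_0_l, ?Rmult_1_l, ?Rinv_0; unfold Rdiv; ring.
    - rewrite RtoC_inv; [reflexivity|]. nra. }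
  apply is_deriv_RtoC. apply Derive_correct. auto_derive. nra.
Qed.

(** The boundary term vanishes at infinity because of the factor 1/y, and G is continuous at the
    limit u of t, which is away from s. It serves u = PI at -oo and u = 0 at +oo. *)
Let lim_t (Fi : (R -> Prop) -> Prop) (u : R) : Filter Fi ->
  - PI < s - u < PI -> s <> u ->
  filterlim t Fi (locally u) -> filterlim Rinv Fi (locally 0) ->
  filterlim F Fi (locally (G u)).
Proof.
intros FF h1 h2 ht hi.
replace (G u) with ((expi (K * u) + - expi (K * s)) * 0%R + G u)%C by ring.
apply filterlim_Cplus.
- apply filterlim_Cscal; [|exact hi].
  apply filterlim_Cplus; [|apply filterlim_const].
  apply (filterlim_comp _ _ _ t (fun u => expi (K * u)) Fi (locally u)); [exact ht|].
  exact (is_deriv_continuous _ _ _ (is_deriv_expi K u)).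
- apply (filterlim_comp _ _ _ t G Fi (locally u)); [exact ht|].
  exact (is_deriv_continuous _ _ _ (deriv_G u h1 h2)).
Qed.

Let lim_F_m : filterlim F (Rbar_locally m_infty) (locally (G PI)).
Proof.
apply lim_t; try lra; try typeclasses eauto.
- apply (filterlim_comp _ _ _ (fun y => (x + y) / L) arccot _ (Rbar_locally m_infty)); [|exact filterlim_arccot_m].
  intros P [M hM]. exists (L * M - x). intros y hy. apply hM.
  apply (Rmult_lt_reg_l L); [exact hL|]. replace (L * ((x + y) / L)) with (x + y) by (field; lra). lra.
- apply (filterlim_Rbar_inv m_infty); discriminate.
Qed.

Let lim_F_p : filterlim F (Rbar_locally p_infty) (locally (G 0)).
Proof.
apply lim_t; try lra; try typeclasses eauto.
- apply (filterlim_comp _ _ _ (fun y => (x + y) / L) arccot _ (Rbar_locally p_infty)); [|exact filterlim_arccot_p].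
  intros P [M hM]. exists (L * M - x). intros y hy. apply hM.
  apply (Rmult_lt_reg_l L); [exact hL|]. replace (L * ((x + y) / L)) with (x + y) by (field; lra). lra.
- apply (filterlim_Rbar_inv p_infty); discriminate.
Qed.

Let lim_F_0 : filterlim (fun eps : R => F (- eps)%R - F eps)%C (at_right 0) (locally (RtoC 0)).
Proof.
(* [mu] is the part of [lam] that is smooth at s, by [ln_tan_half_shift], and [H] below is [G] with
   [mu] in place of [lam]. The remaining ln (y^2) / 2 takes the same value at eps and -eps. *)
set (mu := fun u => ln (sin u * sin s / (L * (1 + cos (s - u))))).
set (B := fun y : R => expi (K * t y)).
set (H := fun u : R => (- (Ci * K * sin s / L) * (Q u - expi (K * s) * sin s * mu u))%C).
assert (t0 : t 0 = s) by (unfold t, s; now rewrite Rplus_0_r).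
pose proof (is_derive_arccot_shift L x 0 hL) as ht. fold t in ht.
assert (hB := is_deriv_comp (fun u => expi (K * u)) t 0 _ _ (is_deriv_expi K (t 0)) ht).
fold B in hB.
assert (B0 : B 0 = expi (K * s)) by (unfold B; now rewrite t0).
(* The boundary terms at -eps and eps are exactly the difference quotients of [B] at 0. They are
   written by coordinates because [filterlim_second_diffq] is real-valued. *)
apply (filterlim_ext_loc (fun eps : R =>
  ((((fst (B (- eps)%R) - fst (B 0)) / (- eps) - (fst (B eps) - fst (B 0)) / eps)%R,
   ((snd (B (- eps)%R) - snd (B 0)) / (- eps) - (snd (B eps) - snd (B 0)) / eps)%R) : C)
  + (H (t (- eps)%R) + (RtoC (-1)) * H (t eps)))%C).
{ exists (mkposreal 1 Rlt_0_1); intros e _ he.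
  assert (E : forall y, y <> 0 -> G (t y) = (H (t y) + - (Ci * K * sin s / L) * - (expi (K * s) * sin s * (ln (y ^ 2) / 2)%R))%C).
  { intros y hy. unfold G, H, lam, mu.
    pose proof (ln_tan_half_shift L x y hL hy) as h. cbv zeta in h. fold s in h.
    change (arccot ((x + y) / L)) with (t y) in h.
    rewrite h, RtoC_plus. ring. }
  unfold F. rewrite !E by lra. replace ((- e) ^ 2) with (e ^ 2) by ring.
  rewrite <- B0. change (expi (K * t (- e))) with (B (- e)). change (expi (K * t e)) with (B e).
  match goal with |- (?p + _ = ?a + (?h1 + ?c) - (?b + (?h2 + ?c)))%C =>
    assert (E1 : (p = a - b)%C) end.
  { apply injective_projections; cbn; field; lra. }
  rewrite E1. ring. }
replace (locally (RtoC 0)) with (locally (RtoC 0 + (H s + (RtoC (-1)) * H s))%C)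
  by (f_equal; ring).
assert (cH : filterlim H (locally s) (locally (H s))).
{ eapply is_deriv_continuous. apply is_deriv_cmult, is_deriv_minus; [apply hQ|].
  apply is_deriv_cmult, is_deriv_RtoC. apply Derive_correct. unfold mu.
  pose proof (sin_gt_0 s).
  auto_derive. rewrite Rplus_opp_r, cos_0. repeat split; try lra.
  apply Rdiv_lt_0_compat; nra. }
assert (le0 : filter_le (at_right 0) (locally 0)) by apply filter_le_within.
assert (ct : filterlim t (at_right 0) (locally s)).
{ rewrite <- t0.
  apply (filterlim_filter_le_1 _ le0).
  apply (ex_derive_continuous (V := R_NormedModule)). eexists; exact ht. }
assert (ct' : filterlim (fun e => t (- e)) (at_right 0) (locally s)).
{ rewrite <- t0.
  apply (filterlim_comp _ _ _ Ropp t (at_right 0) (locally 0)).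
  - apply (filterlim_filter_le_1 _ le0).
    rewrite <- Ropp_0 at 2. apply (filterlim_opp (V := R_NormedModule)).
  - apply (ex_derive_continuous (V := R_NormedModule)). eexists; exact ht. }
apply filterlim_Cplus; [|apply filterlim_Cplus].
- apply filterlim_C; cbn [fst snd].
  + exact (filterlim_second_diffq (fun y => fst (B y)) _ (is_deriv_fst _ _ _ hB)).
  + exact (filterlim_second_diffq (fun y => snd (B y)) _ (is_deriv_snd _ _ _ hB)).
- apply (filterlim_comp _ _ _ (fun e => t (- e)) H _ (locally s)); [exact ct' | exact cH].
- apply filterlim_Ccmult. apply (filterlim_comp _ _ _ t H _ (locally s)); [exact ct | exact cH].
Qed.

Lemma half_laplacian_of_primitive :
  is_half_laplacian (fun z => expi (K * arccot (z / L))) x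
    (Ci * K * sin s / (L * PI)
     * (Q PI - Q 0%R - 2 * expi (K * s) * sin s * ln (cot (s / 2))))%C.
Proof.
(* Since cot is decreasing, y = -oo is t = PI and y = +oo is t = 0; the last 0 is the limit across
   the singularity. *)
exists (G 0%R - G PI + 0)%C; split.
- exact (is_pv_RInt_primitive f F (G PI) (G 0%R) 0 deriv_F cont_f lim_F_m lim_F_p lim_F_0).
- pose proof (ln_cot_half s s_bound) as h.
  change (lam PI - lam 0 = 2 * ln (cot (s / 2))) in h.
  unfold G.
  replace (RtoC (lam PI)) with (RtoC (lam 0%R) + 2 * ln (cot (s / 2)))%C.
  2:{ rewrite <- RtoC_mult, <- RtoC_plus. f_equal. lra. }
  pose proof PI_RGT_0.
  field. split; apply RtoC_neq_0; lra.
Qed.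

End half_laplacian.

(** * Primitives of the kernel *)

Lemma expi_plus (a b : R) : expi (a + b) = (expi a * expi b)%C.
Proof.
apply injective_projections; cbn; [apply cos_plus|].
rewrite sin_plus; ring.
Qed.

Lemma expi_0 : expi 0 = 1%C.
Proof. apply injective_projections; cbn; [apply cos_0 | apply sin_0]. Qed.

Lemma expi_opp_mult (a : R) : (expi (- a) * expi a)%C = 1%C.
Proof. now rewrite <- expi_plus, Rplus_opp_l, expi_0. Qed.

Lemma expi_neq_0 (a : R) : expi a <> 0%C.
Proof.
intros e. apply C1_nz. rewrite <- (expi_opp_mult a), e. ring.
Qed.

Lemma expi_opp (a : R) : expi (- a) = (/ expi a)%C.
Proof.
pose proof (expi_neq_0 a) as h.
replace (expi (- a)) with (expi (- a) * expi a * / expi a)%C by (field; exact h).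
rewrite expi_opp_mult. ring.
Qed.

Lemma Cconj_expi (a : R) : Cconj (expi a) = expi (- a).
Proof. unfold expi, Cconj; cbn. now rewrite cos_neg, sin_neg. Qed.

Lemma Ci_sqr : (Ci * Ci = - (1))%C.
Proof. apply injective_projections; cbn; ring. Qed.

Lemma cos_expi (a : R) : RtoC (cos a) = ((expi a + / expi a) / 2)%C.
Proof.
rewrite <- expi_opp.
apply injective_projections; cbn; rewrite ?cos_neg, ?sin_neg; field.
Qed.

Lemma sin_expi (a : R) : RtoC (sin a) = (- Ci * (expi a - / expi a) / 2)%C.
Proof.
rewrite <- expi_opp.
apply injective_projections; cbn; rewrite ?cos_neg, ?sin_neg; field.
Qed.

Lemma C2_neq_0 : RtoC 2 <> 0%C.
Proof. apply RtoC_neq_0; lra. Qed.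

(** For K = 1 the division is exact: e^(it) sin t - e^(is) sin s = - e^(i(s+t)) sin (s - t). *)
Lemma has_kernel_primitive_1 (s : R) :
  has_kernel_primitive 1 s (- (2 * Ci * expi s))%C.
Proof.
exists (fun t => Ci * expi s * expi (1 * t))%C, (fun t => Ci * expi s * (Ci * 1%R * expi (1 * t)))%C.
split; [|split].
- intros t. apply is_deriv_cmult, is_deriv_expi.
- intros t. rewrite !Rmult_1_l, !sin_expi. unfold Rminus. rewrite expi_plus, expi_opp.
  replace (Ci * expi s * (Ci * 1 * expi t))%C with (Ci * Ci * expi s * expi t)%C by ring.
  rewrite Ci_sqr.
  field. repeat split; auto using expi_neq_0, C2_neq_0.
- rewrite Rmult_1_l, Rmult_0_r, expi_0.
  replace (expi PI) with (- (1))%C; [ring|].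
  apply injective_projections; cbn; rewrite ?cos_PI, ?sin_PI; ring.
Qed.

(** A primitive of e^(ijt) sin t away from the resonances j = 1 and j = -1, where the integrand has
    a nonzero constant term and a primitive grows linearly. *)
Definition expi_sin_primitive (j t : R) : C :=
  (expi (j * t) * (cos t - Ci * j * sin t) / (j ^ 2 - 1)%R)%C.

Lemma is_deriv_expi_sin_primitive (j t : R) : j ^ 2 <> 1 ->
  is_deriv (expi_sin_primitive j) t (expi (j * t) * sin t)%C.
Proof.
intros hj. unfold expi_sin_primitive.
eapply is_deriv_eq.
- apply is_deriv_mult; [apply is_deriv_mult|apply is_deriv_const].
  + apply is_deriv_expi.
  + apply is_deriv_minus; [apply is_deriv_RtoC | apply is_deriv_cmult, is_deriv_RtoC];
    apply Derive_correct; auto_derive; trivial.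
- cbv beta. rewrite (is_derive_unique _ _ _ (is_derive_cos t)), (is_derive_unique _ _ _ (is_derive_sin t)).
  apply injective_projections; cbn; field; lra.
Qed.

(** From e^(i(K+2)t) - e^(2is) e^(iKt) = - 2i e^(is) e^(i(K+1)t) sin (s - t), the new Q is e^(2is) Q
    minus 2i e^(is) times a primitive of e^(i(K+1)t) sin t. The integral of the latter over [0, PI]
    is -2 / (K (K + 2)); oddness of K enters only there, as e^(i(K+1)PI) = 1. The equivalence
    permits descending steps. *)
Lemma has_kernel_primitive_step (K s : R) (q : C) :
  K <> 0 -> K + 2 <> 0 -> expi ((K + 1) * PI) = 1%C ->
  (has_kernel_primitive K s q <->
   has_kernel_primitive (K + 2) s
     (expi s * expi s * q + 4 * Ci * expi s / (K * (K + 2))%R)%C).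
Proof.
intros h0 h2 hp.
assert (hj : (K + 1) ^ 2 <> 1).
{ intros e. assert (h : K * (K + 2) = 0) by nra. apply Rmult_integral in h. tauto. }
assert (hE : (expi_sin_primitive (K + 1) PI - expi_sin_primitive (K + 1) 0 = - (2) / (K * (K + 2))%R)%C).
{ unfold expi_sin_primitive. rewrite hp, Rmult_0_r, expi_0, cos_PI, sin_PI, cos_0, sin_0.
  replace ((K + 1) ^ 2 - 1) with (K * (K + 2)) by ring.
  field. apply RtoC_neq_0. now apply Rmult_integral_contrapositive. }
assert (hK : RtoC (K * (K + 2)) <> 0%C) by (apply RtoC_neq_0; now apply Rmult_integral_contrapositive).
pose proof (expi_neq_0 s) as hs.
assert (key : forall t, (2 * Ci * expi s * sin (s - t) * (expi ((K + 1) * t) * sin t)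
  = expi s * expi s * expi (K * t) * sin t - expi ((K + 2) * t) * sin t)%C).
{ intros t. rewrite (sin_expi (s - t)).
  replace (expi ((K + 2) * t)) with (expi (K * t) * expi t * expi t)%C
    by (rewrite <- !expi_plus; f_equal; ring).
  replace (expi ((K + 1) * t)) with (expi (K * t) * expi t)%C
    by (rewrite <- !expi_plus; f_equal; ring).
  unfold Rminus. rewrite expi_plus, expi_opp.
  match goal with |- (?l = _)%C => replace l with
   (- (Ci * Ci) * expi s * (expi s * / expi t - / (expi s * / expi t)) * (expi (K * t) * expi t * sin t))%C
   by (field; auto using expi_neq_0, C2_neq_0) end.
  rewrite Ci_sqr. field. auto using expi_neq_0. }
assert (es : expi ((K + 2) * s) = (expi s * expi s * expi (K * s))%C)
  by (rewrite <- !expi_plus; f_equal; ring).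
split; intros [Q [DQ [hQ [hD hq]]]].
- exists (fun t => expi s * expi s * Q t - 2 * Ci * expi s * expi_sin_primitive (K + 1) t)%C,
    (fun t => expi s * expi s * DQ t - 2 * Ci * expi s * (expi ((K + 1) * t) * sin t))%C.
  split; [|split].
  + intros t. apply is_deriv_minus; apply is_deriv_cmult; [apply hQ|].
    now apply is_deriv_expi_sin_primitive.
  + intros t. pose proof (hD t) as h. pose proof (key t) as k.
    replace ((expi s * expi s * DQ t - 2 * Ci * expi s * (expi ((K + 1) * t) * sin t)) * sin (s - t))%C
      with (expi s * expi s * (DQ t * sin (s - t)) - 2 * Ci * expi s * sin (s - t) * (expi ((K + 1) * t) * sin t))%C by ring.
    rewrite h, k, es. ring.
  + match goal with |- (_ = ?r)%C => replace r with
      (expi s * expi s * (Q PI - Q 0%R) - 2 * Ci * expi s * (expi_sin_primitive (K + 1) PI - expi_sin_primitive (K + 1) 0%R))%C by ring end.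
    rewrite hE, hq. field. exact hK.
- exists (fun t => / (expi s * expi s) * (Q t + 2 * Ci * expi s * expi_sin_primitive (K + 1) t))%C,
    (fun t => / (expi s * expi s) * (DQ t + 2 * Ci * expi s * (expi ((K + 1) * t) * sin t)))%C.
  split; [|split].
  + intros t. apply is_deriv_cmult, is_deriv_plus; [apply hQ|]. apply is_deriv_cmult.
    now apply is_deriv_expi_sin_primitive.
  + intros t. pose proof (hD t) as h. pose proof (key t) as k.
    replace (/ (expi s * expi s) * (DQ t + 2 * Ci * expi s * (expi ((K + 1) * t) * sin t)) * sin (s - t))%C
      with (/ (expi s * expi s) * (DQ t * sin (s - t) + 2 * Ci * expi s * sin (s - t) * (expi ((K + 1) * t) * sin t)))%C by ring.
    rewrite h, k, es. field. exact hs.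
  + match goal with |- (_ = ?r)%C => replace r with
      (/ (expi s * expi s) * ((Q PI - Q 0%R) + 2 * Ci * expi s * (expi_sin_primitive (K + 1) PI - expi_sin_primitive (K + 1) 0%R)))%C by ring end.
    rewrite hE, <- hq. field. now split.
Qed.

(** The sines are real, so conjugating the defining equation only negates the frequency. *)
Lemma has_kernel_primitive_conj (K s : R) (q : C) :
  has_kernel_primitive K s q -> has_kernel_primitive (- K) s (Cconj q).
Proof.
intros [Q [DQ [hQ [hD hq]]]].
exists (fun t => Cconj (Q t)), (fun t => Cconj (DQ t)). split; [|split].
- intros t. apply is_deriv_pair; cbn.
  + exact (is_deriv_fst _ _ _ (hQ t)).
  + apply (is_derive_opp (V := R_NormedModule)). exact (is_deriv_snd _ _ _ (hQ t)).
- intros t. pose proof (f_equal Cconj (hD t)) as h.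
  rewrite !Ropp_mult_distr_l_reverse, <- !Cconj_expi.
  apply injective_projections; [apply (f_equal fst) in h | apply (f_equal snd) in h];
    cbn in h |- *; lra.
- rewrite hq. apply injective_projections; cbn; ring.
Qed.

(** * The artanh series on the unit circle *)

(** The mean value theorem is applied to g - f and to g + f, whose derivatives are nonnegative. This
    replaces the integration of a bound on the derivative. *)
Lemma diff_le_of_deriv_le (f g df dg : R -> R) :
  (forall r, 0 <= r <= 1 -> is_derive f r (df r)) ->
  (forall r, 0 <= r <= 1 -> is_derive g r (dg r)) ->
  (forall r, 0 <= r <= 1 -> Rabs (df r) <= dg r) ->
  Rabs (f 1 - f 0) <= g 1 - g 0.
Proof.
intros hf hg h.
assert (mvt : forall k dk : R -> R, (forall r, 0 <= r <= 1 -> is_derive k r (dk r)) ->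
  exists c, 0 <= c <= 1 /\ k 1 - k 0 = dk c).
{ intros k dk hk. destruct (MVT_gen k 0 1 dk) as [c [hc e]];
    try (intros r hr; rewrite Rmin_left, Rmax_right in hr by lra).
  - apply hk; lra.
  - apply derivable_continuous_pt. exists (dk r). apply is_derive_Reals, hk, hr.
  - rewrite Rmin_left, Rmax_right in hc by lra. exists c; split; [exact hc | lra]. }
destruct (mvt (fun r => g r - f r) (fun r => dg r - df r)) as [c [hc e]].
{ intros r hr. apply (is_derive_minus (V := R_NormedModule)); auto. }
destruct (mvt (fun r => g r + f r) (fun r => dg r + df r)) as [c' [hc' e']].
{ intros r hr. apply (is_derive_plus (V := R_NormedModule)); auto. }
pose proof (proj1 (Rabs_le_between _ _) (h c hc)).
pose proof (proj1 (Rabs_le_between _ _) (h c' hc')).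
apply Rabs_le_between. lra.
Qed.

Lemma expi_pow (a : R) (n : nat) : (expi a ^ n)%C = expi (INR n * a).
Proof.
induction n as [|n IH]; [now rewrite Rmult_0_l, expi_0|].
rewrite S_INR. replace ((INR n + 1) * a) with (a + INR n * a) by ring.
rewrite expi_plus, <- IH. reflexivity.
Qed.

Section artanh_series.

Variable s : R.
Hypothesis hs : 0 < s < PI.

Let term (r : R) (n : nat) : C := (expi ((2 * INR n + 1) * s) * (r ^ (2 * n + 1) / (2 * INR n + 1))%R)%C.
Let dterm (r : R) (n : nat) : C := (expi ((2 * INR n + 1) * s) * (r ^ (2 * n))%R)%C.

Let A (r : R) := 1 - 2 * r * cos s + r ^ 2.
Let B (r : R) := 1 + 2 * r * cos s + r ^ 2.

(** This is (log (1 + w) - log (1 - w)) / 2 at w = r e^(is), in coordinates: [A r] = |1 - w|^2,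
    [B r] = |1 + w|^2. Both 1 + w and 1 - w have positive real part for 0 <= r <= 1, so their
    arguments are arctangents. *)
Let artanh (r : R) : C :=
  (ln (B r / A r) / 4,
   (atan (r * sin s / (1 + r * cos s)) + atan (r * sin s / (1 - r * cos s))) / 2).
(** The coordinates of e^(is) / (1 - r^2 e^(2is)), whose denominator has squared modulus
    [A r * B r]. *)
Let dartanh (r : R) : C := (cos s * (1 - r ^ 2) / (A r * B r), sin s * (1 + r ^ 2) / (A r * B r)).

Let cos_sin : cos s * cos s = 1 - sin s * sin s.
Proof. pose proof (sin2_cos2 s) as h; unfold Rsqr in h; lra. Qed.

Let sin_pos : 0 < sin s.
Proof. apply sin_gt_0; lra. Qed.

Let A_lower (r : R) : sin s * sin s <= A r.
Proof. unfold A. pose proof (Rle_0_sqr (r - cos s)); unfold Rsqr in *. nra. Qed.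

Let B_lower (r : R) : sin s * sin s <= B r.
Proof. unfold B. pose proof (Rle_0_sqr (r + cos s)); unfold Rsqr in *. nra. Qed.

Let is_deriv_artanh (r : R) : 0 <= r <= 1 -> is_deriv artanh r (dartanh r).
Proof.
intros hr.
assert (hc : -1 < cos s < 1) by (split; nra).
pose proof (A_lower r). pose proof (B_lower r).
assert (0 < sin s * sin s) by nra.
assert (h1 : 0 < 1 + r * cos s) by nra. assert (h2 : 0 < 1 - r * cos s) by nra.
assert (hB : (1 + r * cos s) * (1 + r * cos s) + (r * sin s) * (r * sin s) = B r)
  by (unfold B; replace (r * sin s * (r * sin s)) with (r * r * (sin s * sin s)) by ring;
      replace (sin s * sin s) with (1 - cos s * cos s) by lra; ring).
assert (hA : (1 - r * cos s) * (1 - r * cos s) + (r * sin s) * (r * sin s) = A r)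
  by (unfold A; replace (r * sin s * (r * sin s)) with (r * r * (sin s * sin s)) by ring;
      replace (sin s * sin s) with (1 - cos s * cos s) by lra; ring).
apply is_deriv_pair.
- unfold artanh, dartanh, A, B in *; cbn [fst].
  auto_derive.
  + split; [lra|]. split; [|trivial]. apply Rdiv_lt_0_compat; lra.
  + field. lra.
- unfold artanh, dartanh; cbn [snd].
  assert (E1 : is_derive (fun r => r * sin s / (1 + r * cos s)) r (sin s / ((1 + r * cos s) * (1 + r * cos s))))
    by (auto_derive; [lra | field; lra]).
  assert (E2 : is_derive (fun r => r * sin s / (1 - r * cos s)) r (sin s / ((1 - r * cos s) * (1 - r * cos s))))
    by (auto_derive; [lra | field; lra]).
  evar_last.
  + refine (is_derive_scal_l (V := R_NormedModule)
      (fun r => atan (r * sin s / (1 + r * cos s)) + atan (r * sin s / (1 - r * cos s))) r _ (/ 2) _).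
    apply (is_derive_plus (V := R_NormedModule)).
    * apply (is_derive_comp (V := R_NormedModule) atan (fun r => r * sin s / (1 + r * cos s))).
      -- apply is_derive_atan.
      -- exact E1.
    * apply (is_derive_comp (V := R_NormedModule) atan (fun r => r * sin s / (1 - r * cos s))).
      -- apply is_derive_atan.
      -- exact E2.
  + replace (1 + (r * sin s / (1 + r * cos s))²) with (B r / ((1 + r * cos s) * (1 + r * cos s)))
      by (rewrite <- hB; unfold Rsqr; field; lra).
    replace (1 + (r * sin s / (1 - r * cos s))²) with (A r / ((1 - r * cos s) * (1 - r * cos s)))
      by (rewrite <- hA; unfold Rsqr; field; lra).
    cbn; unfold mult, plus; cbn.
    field_simplify_eq; [|repeat split; lra].
    unfold A, B. ring.
Qed.

Let is_deriv_sum (r : R) (N : nat) :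
  is_deriv (fun r => sum_n (term r) N) r (sum_n (dterm r) N).
Proof.
assert (H : forall n, is_deriv (fun r => term r n) r (dterm r n)).
{ intros n. apply is_deriv_cmult, is_deriv_RtoC.
  pose proof (pos_INR n).
  auto_derive; [trivial|].
  replace (Init.Nat.pred (n + (n + 0) + 1)) with (2 * n)%nat by lia.
  rewrite Rmult_1_l. replace (INR (n + (n + 0) + 1)) with (2 * INR n + 1).
  - field. lra.
  - rewrite !plus_INR. cbn. ring. }
induction N as [|N IH].
- rewrite sum_O. apply (is_derive_ext (V := C_R_NormedModule) (fun r => term r 0)).
  + intros t. now rewrite sum_O.
  + apply H.
- rewrite sum_Sn.
  apply (is_derive_ext (V := C_R_NormedModule) (fun r => plus (sum_n (term r) N) (term r (S N)))).
  + intros t. now rewrite sum_Sn.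
  + apply is_deriv_plus; [exact IH | apply H].
Qed.

Let z : C := expi (2 * s).

(** A finite geometric sum of ratio r^2 z, with the denominator cleared. *)
Let sum_dterm (r : R) (N : nat) :
  ((1 - (r ^ 2)%R * z) * sum_n (dterm r) N = expi s - (r ^ (2 * N + 2))%R * expi ((2 * INR N + 3) * s))%C.
Proof.
induction N as [|N IH].
- rewrite sum_O. unfold dterm, z. cbn [INR Nat.mul Nat.add].
  replace ((2 * 0 + 1) * s) with s by ring.
  replace ((2 * 0 + 3) * s) with (2 * s + s) by ring.
  rewrite expi_plus. cbn [pow]. ring.
- rewrite sum_Sn. change plus with Cplus.
  rewrite Cmult_plus_distr_l, IH. unfold dterm, z.
  rewrite S_INR.
  replace ((2 * (INR N + 1) + 1) * s) with ((2 * INR N + 3) * s) by ring.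
  replace ((2 * (INR N + 1) + 3) * s) with (2 * s + (2 * INR N + 3) * s) by ring.
  rewrite (expi_plus (2 * s)).
  replace (2 * S N)%nat with (2 * N + 2)%nat by lia.
  replace (r ^ (2 * N + 2 + 2)) with (r ^ 2 * r ^ (2 * N + 2)) by (rewrite !pow_add; ring).
  rewrite (RtoC_mult (r ^ 2)). ring.
Qed.

Let dartanh_eq (r : R) : 0 <= r <= 1 -> ((1 - (r ^ 2)%R * z) * dartanh r = expi s)%C.
Proof.
intros hr. pose proof (A_lower r). pose proof (B_lower r).
assert (0 < sin s * sin s) by nra.
unfold z, dartanh, expi.
rewrite cos_2a_sin, sin_2a.
assert (AB : A r * B r = (1 - r ^ 2) ^ 2 + 4 * r ^ 2 * (sin s * sin s)).
{ unfold A, B. replace (sin s * sin s) with (1 - cos s * cos s) by lra. ring. }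
apply injective_projections; cbn [fst snd Cmult Cminus Cplus Copp RtoC].
- apply (Rmult_eq_reg_r (A r * B r)); [|nra].
  replace (_ * (A r * B r)) with
   ((1 - r ^ 2 * (1 - 2 * sin s * sin s)) * (cos s * (1 - r ^ 2))
     + r ^ 2 * (2 * sin s * cos s) * (sin s * (1 + r ^ 2))) by (field; lra).
  rewrite AB. ring.
- apply (Rmult_eq_reg_r (A r * B r)); [|nra].
  replace (_ * (A r * B r)) with
   ((1 - r ^ 2 * (1 - 2 * sin s * sin s)) * (sin s * (1 + r ^ 2))
     - r ^ 2 * (2 * sin s * (cos s * cos s)) * (1 - r ^ 2)) by (field; lra).
  rewrite AB, cos_sin. ring.
Qed.

(** With w = r e^(is), 1 - r^2 z = (1 - w) (1 + w), so the squared modulus is [A r * B r], and each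
    factor is at least sin^2 s. *)
Let Cmod_lower (r : R) : sin s * sin s <= Cmod (1 - (r ^ 2)%R * z)%C.
Proof.
pose proof (A_lower r). pose proof (B_lower r).
assert (0 < sin s * sin s) by nra.
unfold Cmod. rewrite <- (sqrt_Rsqr (sin s * sin s)) by lra.
apply sqrt_le_1_alt. unfold z, expi. rewrite cos_2a_sin, sin_2a. unfold Rsqr.
cbn [fst snd Cmult Cminus Cplus Copp RtoC].
match goal with |- _ <= ?u => replace u with (A r * B r) end; [nra|].
unfold A, B.
transitivity ((1 + r ^ 2) ^ 2 - 4 * r ^ 2 * (cos s * cos s)); [ring|].
match goal with |- _ = ?u => replace u with
  ((1 - r ^ 2 * (1 - 2 * sin s * sin s)) ^ 2 + 4 * r ^ 4 * (sin s * sin s) * (cos s * cos s)) by ring end.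
rewrite cos_sin. ring.
Qed.

(* The integrand of the remainder is r^(2N+2) e^(i(2N+3)s) / (1 - r^2 z); the
   denominator is bounded below by sin^2 s uniformly in r. *)
Let deriv_bound (r : R) (N : nat) : 0 <= r <= 1 ->
  Cmod (sum_n (dterm r) N - dartanh r)%C <= r ^ (2 * N + 2) / (sin s * sin s).
Proof.
intros hr.
assert (0 < sin s * sin s) by nra.
pose proof (Cmod_lower r) as hl.
apply (Rmult_le_reg_l (sin s * sin s)); [assumption|].
replace (sin s * sin s * (r ^ (2 * N + 2) / (sin s * sin s))) with (r ^ (2 * N + 2)) by (field; lra).
eapply Rle_trans; [apply Rmult_le_compat_r; [apply Cmod_ge_0 | exact hl]|].
rewrite <- Cmod_mult.
replace ((1 - (r ^ 2)%R * z) * (sum_n (dterm r) N - dartanh r))%C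
  with ((1 - (r ^ 2)%R * z) * sum_n (dterm r) N - (1 - (r ^ 2)%R * z) * dartanh r)%C by ring.
rewrite sum_dterm, dartanh_eq by assumption.
replace (expi s - _ - expi s)%C with (- ((r ^ (2 * N + 2))%R * expi ((2 * INR N + 3) * s)))%C by ring.
rewrite Cmod_opp, Cmod_mult, Cmod_R, Rabs_pos_eq by (apply pow_le; lra).
replace (Cmod (expi _)) with 1; [lra|].
unfold Cmod, expi; cbn [fst snd].
rewrite <- sqrt_1. f_equal. pose proof (sin2_cos2 ((2 * INR N + 3) * s)) as h. unfold Rsqr in h. lra.
Qed.

(** [deriv_bound] integrated over [0, 1]: the factor 1 / (2N + 3) is the integral of r^(2N+2). Since
    the bound holds on the closed interval, convergence at r = 1 follows without an Abel limit. *)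
Let remainder (N : nat) :
  Rabs (fst (sum_n (term 1) N) - fst (artanh 1)) <= / (sin s * sin s) / (2 * INR N + 3) /\
  Rabs (snd (sum_n (term 1) N) - snd (artanh 1)) <= / (sin s * sin s) / (2 * INR N + 3).
Proof.
assert (0 < sin s * sin s) by nra.
pose proof (pos_INR N).
set (D := fun r => (sum_n (term r) N - artanh r)%C).
set (g := fun r => r ^ (2 * N + 3) / (sin s * sin s) / (2 * INR N + 3)).
assert (hD : forall r, 0 <= r <= 1 -> is_deriv D r (sum_n (dterm r) N - dartanh r)%C).
{ intros r hr. apply is_deriv_minus; [apply is_deriv_sum | now apply is_deriv_artanh]. }
assert (hg : forall r, is_derive g r (r ^ (2 * N + 2) / (sin s * sin s))).
{ intros r. unfold g. auto_derive; [trivial|].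
  replace (Init.Nat.pred (N + (N + 0) + 3)) with (2 * N + 2)%nat by lia.
  replace (INR (N + (N + 0) + 3)) with (2 * INR N + 3) by (rewrite !plus_INR; cbn; ring).
  field. lra. }
assert (D0 : D 0 = 0%C).
{ unfold D, artanh, A, B.
  assert (E : sum_n (term 0) N = RtoC 0).
  { assert (T : forall n, term 0 n = 0%C).
    { intros n. unfold term. rewrite pow_add, pow_1, Rmult_0_r. unfold Rdiv. rewrite Rmult_0_l. ring. }
    clear -T. induction N as [|N IH]; [rewrite sum_O; apply T|].
    rewrite sum_Sn, IH, T. apply (Cplus_0_r 0). }
  rewrite E.
  apply injective_projections; cbn [fst snd Cminus Cplus Copp RtoC].
  - rewrite !Rmult_0_r, !Rmult_0_l, pow_i by lia.
    replace ((1 + 0 + 0) / (1 - 0 + 0)) with 1 by field. rewrite ln_1. field.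
  - rewrite !Rmult_0_l. unfold Rdiv. rewrite !Rmult_0_l, atan_0. ring. }
assert (g1 : g 1 - g 0 = / (sin s * sin s) / (2 * INR N + 3)).
{ unfold g. rewrite pow1, pow_i by lia. field. lra. }
rewrite <- g1.
assert (hb : forall r, 0 <= r <= 1 ->
  Rmax (Rabs (fst (sum_n (dterm r) N - dartanh r)%C)) (Rabs (snd (sum_n (dterm r) N - dartanh r)%C))
  <= r ^ (2 * N + 2) / (sin s * sin s)).
{ intros r hr. eapply Rle_trans; [apply Rmax_Cmod | now apply deriv_bound]. }
split.
- replace (_ - _) with (fst (D 1) - fst (D 0)) by (rewrite D0; cbn; ring).
  apply (diff_le_of_deriv_le (fun r => fst (D r)) g
    (fun r => fst (sum_n (dterm r) N - dartanh r)%C) (fun r => r ^ (2 * N + 2) / (sin s * sin s))); auto.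
  + intros r hr. exact (is_deriv_fst _ _ _ (hD r hr)).
  + intros r hr. eapply Rle_trans; [apply Rmax_l | apply (hb r hr)].
- replace (_ - _) with (snd (D 1) - snd (D 0)) by (rewrite D0; cbn; ring).
  apply (diff_le_of_deriv_le (fun r => snd (D r)) g
    (fun r => snd (sum_n (dterm r) N - dartanh r)%C) (fun r => r ^ (2 * N + 2) / (sin s * sin s))); auto.
  + intros r hr. exact (is_deriv_snd _ _ _ (hD r hr)).
  + intros r hr. eapply Rle_trans; [apply Rmax_r | apply (hb r hr)].
Qed.

(** At r = 1 the two arctangents are s/2 and PI/2 - s/2, so the imaginary part does not depend on
    s. *)
Let artanh_1 : artanh 1 = (ln (cot (s / 2)) / 2, PI / 4).
Proof.
assert (h1 : 0 < cos (s / 2)) by (apply cos_gt_0; lra).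
assert (h2 : 0 < sin (s / 2)) by (apply sin_gt_0; lra).
pose proof (sin2_cos2 (s / 2)) as h3; unfold Rsqr in h3.
assert (hc : 0 < cot (s / 2)) by (now apply Rdiv_lt_0_compat).
unfold artanh, A, B.
assert (Ec : cos s = cos (s / 2) * cos (s / 2) - sin (s / 2) * sin (s / 2))
  by (rewrite <- cos_2a; f_equal; field).
assert (Es : sin s = 2 * sin (s / 2) * cos (s / 2)) by (rewrite <- sin_2a; f_equal; field).
rewrite Ec, Es. rewrite !Rmult_1_r, !Rmult_1_l, pow1.
set (S := sin (s / 2)) in *. set (D := cos (s / 2)) in *.
f_equal.
- replace (1 + 2 * (D * D - S * S) + 1) with (4 * (D * D)) by nra.
  replace (1 - 2 * (D * D - S * S) + 1) with (4 * (S * S)) by nra.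
  replace (4 * (D * D) / (4 * (S * S))) with (cot (s / 2) * cot (s / 2))
    by (unfold cot; fold S D; field; lra).
  rewrite ln_mult by assumption. field.
- replace (1 + (D * D - S * S)) with (2 * (D * D)) by nra.
  replace (1 - (D * D - S * S)) with (2 * (S * S)) by nra.
  replace (2 * S * D / (2 * (D * D))) with (tan (s / 2)) by (unfold tan; fold S D; field; lra).
  replace (2 * S * D / (2 * (S * S))) with (/ tan (s / 2)) by (unfold tan; fold S D; field; lra).
  rewrite atan_inv by (apply tan_gt_0; lra).
  field.
Qed.

Lemma is_series_artanh :
  is_series (V := C_NormedModule) (fun n : nat => expi ((2 * INR n + 1) * s) / (2 * INR n + 1)%R)%C
    (ln (cot (s / 2)) / 2, PI / 4).
Proof.
apply (is_series_ext (V := C_NormedModule) (term 1)).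
{ intros n. unfold term. rewrite pow1. unfold Rdiv, Cdiv. rewrite Rmult_1_l, RtoC_inv; [reflexivity|].
  pose proof (pos_INR n); lra. }
rewrite <- artanh_1.
assert (0 < / (sin s * sin s)) by (apply Rinv_0_lt_compat; nra).
assert (H1 : forall eps : posreal, eventually (fun N => / (sin s * sin s) / (2 * INR N + 3) < eps)).
{ intros eps. pose proof (cond_pos eps).
  destruct (nfloor_ex (/ (sin s * sin s) / eps)) as [M [_ hM]].
  { apply Rlt_le, Rdiv_lt_0_compat; lra. }
  exists M. intros N hN. apply le_INR in hN. pose proof (pos_INR M).
  apply Rlt_div_l; [lra|]. apply Rlt_div_l in hM; [|lra]. nra. }
apply (filterlim_C (sum_n (term 1))); apply filterlim_locally; intros eps;
  generalize (H1 eps); apply filter_imp; intros N hN; destruct (remainder N) as [h1 h2].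
- eapply Rle_lt_trans; [exact h1 | exact hN].
- eapply Rle_lt_trans; [exact h2 | exact hN].
Qed.

End artanh_series.

(** * Values of the kernel integral by series *)

(** The terms of half the Lerch transcendent Phi(z, 1, m/2). *)
Definition lerch_term (z : C) (m : R) (n : nat) : C := (z ^ n / (2 * INR n + m)%R)%C.

Definition is_lerch (z : C) (m : R) (T : C) : Prop :=
  is_series (V := C_NormedModule) (lerch_term z m) T.

(** Shifting the index trades m for m + 2, so the sum at m = 1 determines the sums at all odd m. *)
Lemma lerch_term_S (z : C) (m : R) (n : nat) :
  lerch_term z m (S n) = (z * lerch_term z (m + 2) n)%C.
Proof.
unfold lerch_term. rewrite S_INR.
replace (2 * (INR n + 1) + m) with (2 * INR n + (m + 2)) by ring.
cbn [Cpow]. unfold Cdiv. ring.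
Qed.

Lemma lerch_term_0 (z : C) (m : R) : lerch_term z m 0 = (/ m)%C.
Proof.
unfold lerch_term. cbn [INR Cpow]. rewrite Rmult_0_r, Rplus_0_l.
unfold Cdiv. ring.
Qed.

Lemma is_lerch_pred (z : C) (m : R) (T : C) :
  is_lerch z (m + 2) T -> is_lerch z m (/ m + z * T)%C.
Proof.
intros h.
apply (is_series_decr_1 (V := C_NormedModule)).
rewrite lerch_term_0.
match goal with |- is_series _ ?l => replace l with (z * T)%C end.
2:{ transitivity (/ m + z * T + - / m)%C; [ring | reflexivity]. }
apply (is_series_ext (V := C_NormedModule) (fun n => z * lerch_term z (m + 2) n)%C).
{ intros n. now rewrite lerch_term_S. }
exact (is_series_scal (V := C_NormedModule) z _ T h).
Qed.

Lemma is_lerch_succ (z : C) (m : R) (T : C) : z <> 0%C ->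
  is_lerch z m T -> is_lerch z (m + 2) (/ z * (T - / m))%C.
Proof.
intros hz h.
apply (is_series_ext (V := C_NormedModule) (fun n => / z * lerch_term z m (S n))%C).
{ intros n. rewrite lerch_term_S. rewrite Cmult_assoc, Cinv_l by exact hz. apply Cmult_1_l. }
apply (is_series_scal (V := C_NormedModule) (/ z)%C).
apply (is_series_incr_1 (V := C_NormedModule)).
rewrite lerch_term_0.
match goal with |- is_series _ ?l => replace l with T end; [exact h|].
transitivity (T - / m + / m)%C; [ring | reflexivity].
Qed.

Lemma is_lerch_1 (s : R) : 0 < s < PI ->
  is_lerch (expi (2 * s)) 1 ((ln (cot (s / 2)) + Ci * PI / 2) / (2 * expi s))%C.
Proof.
intros hs.
assert (E : ((ln (cot (s / 2)) + Ci * PI / 2) / (2 * expi s))%C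
  = (/ expi s * (ln (cot (s / 2)) / 2, PI / 4)%R)%C).
{ replace (ln (cot (s / 2)) / 2, PI / 4)%R with ((ln (cot (s / 2)) + Ci * PI / 2) / 2)%C.
  - field. auto using expi_neq_0, C2_neq_0.
  - apply injective_projections; cbn; field. }
rewrite E.
apply (is_series_ext (V := C_NormedModule)
  (fun n => / expi s * (expi ((2 * INR n + 1) * s) / (2 * INR n + 1)%R))%C).
{ intros n. unfold lerch_term. rewrite expi_pow.
  replace ((2 * INR n + 1) * s) with (s + INR n * (2 * s)) by ring.
  rewrite expi_plus. unfold Cdiv. rewrite !Cmult_assoc, Cinv_l by apply expi_neq_0.
  now rewrite Cmult_1_l. }
apply (is_series_scal (V := C_NormedModule) (/ expi s)%C).
now apply is_series_artanh.
Qed.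

Lemma expi_2PI : expi (2 * PI) = 1%C.
Proof. apply injective_projections; cbn; [apply cos_2PI | apply sin_2PI]. Qed.

Lemma IZR_odd_shift_neq_0 (m j : Z) : IZR (2 * m + 1) + 2 * IZR j <> 0.
Proof.
rewrite <- mult_IZR, <- plus_IZR. intros e. apply eq_IZR in e. lia.
Qed.

(* Here a = e^(is), S = sin s and e = e^(iKs); w and X are the coefficients of e. *)
Lemma kernel_value_step_algebra (K a w Ta Tb Tc e S X : C) :
  a <> 0%C -> S <> 0%C -> K <> 0%C -> (K + 2 <> 0)%C -> (K + 4 <> 0)%C ->
  (a * S * (2 * Ci) = a * a - 1)%C ->
  (Ta = / (- K - 2) + a * a * Tb)%C -> (Tb = / (- K) + a * a * Tc)%C ->
  (a * a * ((- (2) / (K * (K + 2)) + w * e + (Ta - 2 * Tb + Tc) + X * e) / S)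
   + 4 * Ci * a / (K * (K + 2))
   = (- (2) / ((K + 2) * (K + 4)) + w * (a * a * e) + (/ (- K - 4) + a * a * Ta - 2 * Ta + Tb)
     + X * (a * a * e)) / S)%C.
Proof.
intros ha hS hK h2 h4 hc hTa hTb.
assert (E : (4 * Ci * a = 2 * (a * a - 1) / S)%C) by (rewrite <- hc; field; exact hS).
rewrite E, hTa, hTb.
assert (hm : (- K - 2 <> 0)%C) by (intros e0; apply h2; replace (K + 2)%C with (- (- K - 2))%C by ring; rewrite e0; ring).
assert (hm4 : (- K - 4 <> 0)%C) by (intros e0; apply h4; replace (K + 4)%C with (- (- K - 4))%C by ring; rewrite e0; ring).
field. repeat split; auto.
Qed.

Section formulas.

Variable s : R.
Hypothesis hs : 0 < s < PI.

Let sin_neq_0 : RtoC (sin s) <> 0%C.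
Proof. apply RtoC_neq_0. pose proof (sin_gt_0 s). lra. Qed.

Let a_neq_0 := expi_neq_0 s.

Let hsin : RtoC (sin s) = (- Ci * (expi s - / expi s) / 2)%C.
Proof. apply sin_expi. Qed.

(** The combination Ta - 2 Tb + Tc is the hypergeometric sum up to a factor, by [hyp2F1_lerch]. The
    logarithmic term cancels the one in [half_laplacian_of_kernel_primitive], and the term in i PI
    becomes -(K/L) sin^2(s) e^(iKs). *)
Definition lerch_kernel_value (K : R) (Ta Tb Tc : C) : C :=
  ((- (2) / (K * (K + 2)) + Ci * PI * (sin s * sin s) * expi (K * s)
    + (Ta - 2 * Tb + Tc)
    + 2 * expi (K * s) * (sin s * sin s) * ln (cot (s / 2))) / sin s)%C.

(** The three consecutive sums are existential and tied by their recurrences, so a step in K only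
    shifts the triple by one place. *)
Definition lerch_invariant (K : R) : Prop :=
  expi ((K + 1) * PI) = 1%C /\
  exists Ta Tb Tc : C,
    is_lerch (expi (2 * s)) (- K - 2) Ta /\ is_lerch (expi (2 * s)) (- K) Tb /\
    is_lerch (expi (2 * s)) (- K + 2) Tc /\
    (Ta = / (- K - 2) + expi s * expi s * Tb)%C /\ (Tb = / (- K) + expi s * expi s * Tc)%C /\
    has_kernel_primitive K s (lerch_kernel_value K Ta Tb Tc).

Let aSC : (expi s * sin s * (2 * Ci) = expi s * expi s - 1)%C.
Proof.
rewrite hsin.
transitivity (- (Ci * Ci) * (expi s * expi s - 1))%C; [field; auto using C2_neq_0|].
rewrite Ci_sqr; ring.
Qed.

Let z_eq : expi (2 * s) = (expi s * expi s)%C.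
Proof. rewrite <- expi_plus. f_equal. ring. Qed.

Let es (K : R) : expi ((K + 2) * s) = (expi s * expi s * expi (K * s))%C.
Proof. rewrite <- !expi_plus; f_equal; ring. Qed.

Lemma lerch_invariant_1 : lerch_invariant 1.
Proof.
pose proof (is_lerch_1 s hs) as hT.
set (T := ((ln (cot (s / 2)) + Ci * PI / 2) / (2 * expi s))%C) in *.
split; [replace ((1 + 1) * PI) with (2 * PI) by ring; exact expi_2PI|].
exists (/ (-3) + expi (2 * s) * (/ (-1) + expi (2 * s) * T))%C, (/ (-1) + expi (2 * s) * T)%C, T.
assert (h1 : is_lerch (expi (2 * s)) (-1) (/ (-1) + expi (2 * s) * T)%C).
{ apply is_lerch_pred. now replace (-1 + 2) with 1 by ring. }
assert (h3 : is_lerch (expi (2 * s)) (-3) (/ (-3) + expi (2 * s) * (/ (-1) + expi (2 * s) * T))%C).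
{ apply is_lerch_pred. now replace (-3 + 2) with (-1) by ring. }
split; [now replace (- (1) - 2) with (-3) by ring|].
split; [now replace (- (1)) with (-1) by ring|].
split; [now replace (- (1) + 2) with 1 by ring|].
split; [rewrite <- z_eq; f_equal; f_equal; apply injective_projections; cbn; ring|].
split; [rewrite <- z_eq; f_equal; f_equal; apply injective_projections; cbn; ring|].
replace (lerch_kernel_value 1 _ _ _) with (- (2 * Ci * expi s))%C; [apply has_kernel_primitive_1|].
unfold lerch_kernel_value. rewrite z_eq, Rmult_1_l.
(* By the choice of [T] both transcendental terms together equal -(z - 1)^2 T, with z = e^(2is).
   They cancel the part (z - 1)^2 T of Ta - 2 Tb + Tc and leave an algebraic expression. *)
assert (E : (Ci * PI * (sin s * sin s) * expi s + 2 * expi s * (sin s * sin s) * ln (cot (s / 2))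
  = 4 * (expi s * sin s) * (expi s * sin s) * T)%C).
{ unfold T. field. auto using C2_neq_0. }
assert (E2 : (4 * (expi s * sin s) * (expi s * sin s) = - (expi s * expi s - 1) * (expi s * expi s - 1))%C).
{ rewrite <- aSC. transitivity (- (Ci * Ci) * (4 * (expi s * sin s) * (expi s * sin s)))%C; [rewrite Ci_sqr|]; ring. }
rewrite E2 in E.
match goal with |- (_ = ?n / _)%C => replace n with (1 - expi s * expi s)%C end.
- replace (1 - expi s * expi s)%C with (- (expi s * expi s - 1))%C by ring.
  rewrite <- aSC. field. exact sin_neq_0.
- match goal with |- (_ = ?c + ?w + ?t + ?u)%C => transitivity (c + t + (w + u))%C; [rewrite E|ring] end.
  replace (RtoC (-3)) with (- (3))%C by (apply injective_projections; cbn; ring).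
  replace (RtoC (-1)) with (- (1))%C by (apply injective_projections; cbn; ring).
  field.
Qed.

Let C_shift_neq_0 (K : R) (c : R) : K + c <> 0 -> (K + c <> 0)%C.
Proof. intros h. rewrite <- RtoC_plus. now apply RtoC_neq_0. Qed.

Lemma lerch_invariant_succ (K : R) : K <> 0 -> K + 2 <> 0 -> K + 4 <> 0 ->
  lerch_invariant K -> lerch_invariant (K + 2).
Proof.
intros h0 h2 h4 [hp [Ta [Tb [Tc [ha [hb [hc [ea [eb hk]]]]]]]]].
split.
{ replace ((K + 2 + 1) * PI) with ((K + 1) * PI + 2 * PI) by ring.
  rewrite expi_plus, hp, expi_2PI. ring. }
exists (/ (- K - 4) + expi s * expi s * Ta)%C, Ta, Tb.
split.
{ replace (- (K + 2) - 2) with (- K - 4) by ring.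
  replace (/ (- K - 4))%C with (/ (- K - 4)%R)%C by (rewrite RtoC_minus, RtoC_opp; reflexivity).
  rewrite <- z_eq. apply is_lerch_pred. now replace (- K - 4 + 2) with (- K - 2) by ring. }
split; [now replace (- (K + 2)) with (- K - 2) by ring|].
split; [now replace (- (K + 2) + 2) with (- K) by ring|].
split; [f_equal; f_equal; rewrite RtoC_plus; ring|].
split; [rewrite ea; f_equal; f_equal; rewrite RtoC_plus; ring|].
apply (proj1 (has_kernel_primitive_step _ _ _ h0 h2 hp)) in hk.
match type of hk with has_kernel_primitive _ _ ?q => replace (lerch_kernel_value _ _ _ _) with q; [exact hk|] end.
unfold lerch_kernel_value.
pose proof (kernel_value_step_algebra K (expi s) (Ci * PI * (sin s * sin s))%C Ta Tb Tc (expi (K * s)) (sin s)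
  (2 * (sin s * sin s) * ln (cot (s / 2)))%C) as H.
rewrite es, RtoC_mult, RtoC_plus.
replace (2 * expi (K * s) * (sin s * sin s) * ln (cot (s / 2)))%C
  with (2 * (sin s * sin s) * ln (cot (s / 2)) * expi (K * s))%C by ring.
rewrite H; auto using RtoC_neq_0.
f_equal.
replace (K + 2 + 2)%C with (K + 4)%C by (apply injective_projections; cbn; ring).
ring.
Qed.

(** The step at K - 2 read backwards; the new third sum [Td] comes from dropping the first term of
    [Tc] and dividing by z. *)
Lemma lerch_invariant_pred (K : R) : K <> 0 -> K - 2 <> 0 -> K + 2 <> 0 ->
  lerch_invariant K -> lerch_invariant (K - 2).
Proof.
intros h0 h2 h4 [hp [Ta [Tb [Tc [ha [hb [hc [ea [eb hk]]]]]]]]].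
assert (hp' : expi ((K - 2 + 1) * PI) = 1%C).
{ replace ((K + 1) * PI) with ((K - 2 + 1) * PI + 2 * PI) in hp by ring.
  now rewrite expi_plus, expi_2PI, Cmult_1_r in hp. }
split; [exact hp'|].
set (Td := (/ expi (2 * s) * (Tc - / (- K + 2)%R))%C).
assert (ed : (Tc = / (- (K - 2)%R) + expi s * expi s * Td)%C).
{ unfold Td. rewrite z_eq.
  replace (- (K - 2)%R)%C with (RtoC (- K + 2)) by (apply injective_projections; cbn; ring).
  field. split; [apply RtoC_neq_0; lra | exact a_neq_0]. }
exists Tb, Tc, Td.
split; [now replace (- (K - 2) - 2) with (- K) by ring|].
split; [now replace (- (K - 2)) with (- K + 2) by ring|].
split; [replace (- (K - 2) + 2) with (- K + 2 + 2) by ring; apply is_lerch_succ; [apply expi_neq_0 | exact hc]|].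
assert (eb' : (Tb = / (- (K - 2)%R - 2) + expi s * expi s * Tc)%C).
{ rewrite eb. f_equal. f_equal. apply injective_projections; cbn; ring. }
split; [exact eb'|].
split; [exact ed|].
apply (proj2 (has_kernel_primitive_step (K - 2) s _ h2 ltac:(lra) hp')).
replace (K - 2 + 2) with K by ring.
match goal with |- has_kernel_primitive _ _ ?q => replace q with (lerch_kernel_value K Ta Tb Tc); [exact hk|] end.
unfold lerch_kernel_value.
pose proof (kernel_value_step_algebra (K - 2)%R (expi s) (Ci * PI * (sin s * sin s))%C Tb Tc Td (expi ((K - 2) * s)) (sin s)
  (2 * (sin s * sin s) * ln (cot (s / 2)))%C) as H.
replace (2 * expi ((K - 2) * s) * (sin s * sin s) * ln (cot (s / 2)))%C
  with (2 * (sin s * sin s) * ln (cot (s / 2)) * expi ((K - 2) * s))%C by ring.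
rewrite RtoC_mult. replace (RtoC K) with ((K - 2)%R + 2)%C by (apply injective_projections; cbn; ring).
rewrite H; auto using RtoC_neq_0.
- replace (expi (K * s)) with (expi s * expi s * expi ((K - 2) * s))%C
    by (rewrite <- es; f_equal; ring).
  f_equal.
  replace ((K - 2)%R + 2 + 2)%C with ((K - 2)%R + 4)%C by (apply injective_projections; cbn; ring).
  rewrite ea. replace (/ ((- K) - 2))%C with (/ (- (K - 2)%R - 4))%C
    by (f_equal; apply injective_projections; cbn; ring).
  ring.
- apply C_shift_neq_0. lra.
- apply C_shift_neq_0. lra.
Qed.

Lemma lerch_invariant_odd (m : Z) : lerch_invariant (IZR (2 * m + 1)).
Proof.
induction m as [|m IH|m IH] using Z.peano_ind.
- exact lerch_invariant_1.
- replace (IZR (2 * Z.succ m + 1)) with (IZR (2 * m + 1) + 2) by (rewrite <- plus_IZR; f_equal; lia).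
  pose proof (IZR_odd_shift_neq_0 m 0). pose proof (IZR_odd_shift_neq_0 m 1). pose proof (IZR_odd_shift_neq_0 m 2).
  apply lerch_invariant_succ; [lra | lra | lra | exact IH].
- replace (IZR (2 * Z.pred m + 1)) with (IZR (2 * m + 1) - 2) by (rewrite <- minus_IZR; f_equal; lia).
  pose proof (IZR_odd_shift_neq_0 m 0). pose proof (IZR_odd_shift_neq_0 m (-1)). pose proof (IZR_odd_shift_neq_0 m 1).
  apply lerch_invariant_pred; [lra | lra | lra | exact IH].
Qed.

End formulas.

(** * The two closed forms *)

Definition expi_sum (sg s : R) (N : nat) : C :=
  sum_n (fun n : nat =>
    4 * expi (- sg * (2 * INR n + 1) * s)
    / ((2 * INR n - 1) * (2 * INR n + 1) * (2 * INR n + 3))%R)%C N.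

Lemma expi_sum_S (sg s : R) (N : nat) :
  expi_sum sg s (S N) = (expi_sum sg s N +
    4 * expi (- sg * (2 * INR N + 3) * s)
    / ((2 * INR N + 1) * (2 * INR N + 3) * (2 * INR N + 5))%R)%C.
Proof.
unfold expi_sum. rewrite sum_Sn, S_INR.
replace (2 * (INR N + 1) - 1) with (2 * INR N + 1) by ring.
replace (2 * (INR N + 1) + 1) with (2 * INR N + 3) by ring.
replace (2 * (INR N + 1) + 3) with (2 * INR N + 5) by ring.
reflexivity.
Qed.

Lemma Cconj_R (r : R) : Cconj r = r.
Proof. apply injective_projections; cbn; ring. Qed.

Lemma Cconj_div_R (c : C) (r : R) : Cconj (c / r)%C = (Cconj c / r)%C.
Proof.
unfold Cdiv. rewrite Cmult_conj. f_equal.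
apply injective_projections; cbn; [reflexivity|].
unfold Rdiv. ring.
Qed.

Lemma Cconj_expi_sum (sg s : R) (N : nat) :
  Cconj (expi_sum sg s N) = expi_sum (- sg) s N.
Proof.
induction N as [|N IH].
- unfold expi_sum. rewrite !sum_O, Cconj_div_R, Cmult_conj, Cconj_R, Cconj_expi.
  do 3 f_equal. ring.
- rewrite !expi_sum_S, <- IH, Cplus_conj, Cconj_div_R, Cmult_conj, Cconj_R, Cconj_expi.
  do 4 f_equal. ring.
Qed.

(** The value of q for which [half_laplacian_of_kernel_primitive] yields the finite formula at K =
    sg (2n + 1). *)
Definition finite_kernel_value (sg s : R) (n : nat) : C :=
  ((- (2) / ((2 * INR n + 1) * (2 * INR n + 3))%R
   - 2 * expi (sg * (2 * INR n + 1) * s) * (cos s + expi_sum sg s n)) / sin s)%C.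

Lemma Cconj_finite_kernel_value (sg s : R) (n : nat) :
  Cconj (finite_kernel_value sg s n) = finite_kernel_value (- sg) s n.
Proof.
unfold finite_kernel_value.
replace (- sg * (2 * INR n + 1) * s) with (- (sg * (2 * INR n + 1) * s)) by ring.
rewrite <- Cconj_expi, <- Cconj_expi_sum.
now rewrite Cconj_div_R, Cminus_conj, Cconj_div_R, !Cmult_conj, Cplus_conj, Copp_conj, !Cconj_R.
Qed.

(** With k = 2n + 1, the step leaves the discrepancy 2 / (k (k + 2)) - 2 / ((k + 2) (k + 4)) = 8 /
    (k (k + 2) (k + 4)), which is the next term of the sum; hence the products of three consecutive
    odd numbers. The condition on e^(i(K+1)PI) rides along because the step requires it. *)
Lemma has_kernel_primitive_finite (s : R) (n : nat) : 0 < s < PI ->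
  expi ((2 * INR n + 1 + 1) * PI) = 1%C /\
  has_kernel_primitive (2 * INR n + 1) s (finite_kernel_value 1 s n).
Proof.
intros hs.
assert (hS : RtoC (sin s) <> 0%C) by (apply RtoC_neq_0; pose proof (sin_gt_0 s); lra).
pose proof (expi_neq_0 s) as ha.
assert (aSC : (expi s * sin s * (2 * Ci) = expi s * expi s - 1)%C).
{ rewrite sin_expi.
  transitivity (- (Ci * Ci) * (expi s * expi s - 1))%C; [field; auto using C2_neq_0|].
  rewrite Ci_sqr; ring. }
induction n as [|n [hp IH]].
- cbn [INR]. rewrite Rmult_0_r, Rplus_0_l.
  split; [exact expi_2PI|].
  replace (finite_kernel_value 1 s 0) with (- (2 * Ci * expi s))%C; [apply has_kernel_primitive_1|].
  unfold finite_kernel_value, expi_sum. rewrite sum_O. cbn [INR].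
  rewrite !Rmult_1_l, !Rmult_0_r, !Rplus_0_l, !Rmult_1_l.
  replace (- (1) * 1 * s) with (- s) by ring.
  rewrite expi_opp.
  replace ((0 - 1) * 1 * 3) with (-3) by ring.
  replace (RtoC (-3)) with (- (3))%C by (apply injective_projections; cbn; ring).
  match goal with |- (_ = ?n / _)%C => replace n with (1 - expi s * expi s)%C end.
  + replace (1 - expi s * expi s)%C with (- (expi s * expi s - 1))%C by ring.
    rewrite <- aSC. field. exact hS.
  + rewrite cos_expi. field. exact ha.
- pose proof (pos_INR n) as hn.
  split.
  { rewrite S_INR. replace ((2 * (INR n + 1) + 1 + 1) * PI) with ((2 * INR n + 1 + 1) * PI + 2 * PI) by ring.
    rewrite expi_plus, hp, expi_2PI. ring. }
  apply (has_kernel_primitive_step (2 * INR n + 1) s _ ltac:(lra) ltac:(lra) hp) in IH.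
  rewrite S_INR. replace (2 * (INR n + 1) + 1) with (2 * INR n + 1 + 2) by ring.
  match type of IH with has_kernel_primitive _ _ ?q => replace (finite_kernel_value 1 s (S n)) with q; [exact IH|] end.
  unfold finite_kernel_value. rewrite expi_sum_S, S_INR, !Rmult_1_l.
  replace (2 * (INR n + 1) + 1) with (2 * INR n + 3) by ring.
  replace (2 * (INR n + 1) + 3) with (2 * INR n + 5) by ring.
  replace (2 * INR n + 1 + 2) with (2 * INR n + 3) by ring.
  replace (- (1) * (2 * INR n + 3) * s) with (- ((2 * INR n + 3) * s)) by ring.
  rewrite expi_opp.
  replace ((2 * INR n + 3) * s) with (s + s + (2 * INR n + 1) * s) by ring.
  rewrite !expi_plus.
  assert (E : (4 * Ci * expi s = 2 * (expi s * expi s - 1) / sin s)%C) by (rewrite <- aSC; field; exact hS).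
  rewrite E.
  rewrite !RtoC_mult.
  assert (h1 : RtoC (2 * INR n + 1) <> 0%C) by (apply RtoC_neq_0; lra).
  replace (RtoC (2 * INR n + 3)) with ((2 * INR n + 1)%R + 2)%C by (apply injective_projections; cbn; ring).
  replace (RtoC (2 * INR n + 5)) with ((2 * INR n + 1)%R + 4)%C by (apply injective_projections; cbn; ring).
  assert (h2 : ((2 * INR n + 1)%R + 2 <> 0)%C) by (rewrite <- RtoC_plus; apply RtoC_neq_0; lra).
  assert (h4 : ((2 * INR n + 1)%R + 4 <> 0)%C) by (rewrite <- RtoC_plus; apply RtoC_neq_0; lra).
  pose proof (expi_neq_0 ((2 * INR n + 1) * s)) as he.
  set (k := RtoC (2 * INR n + 1)) in *. set (e := expi ((2 * INR n + 1) * s)) in *.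
  set (a := expi s) in *. set (w := (RtoC (cos s) + expi_sum 1 s n)%C).
  replace (cos s + (expi_sum 1 s n + 4 * / (a * a * e) / (k * (k + 2) * (k + 4))))%C
    with (w + 4 * / (a * a * e) / (k * (k + 2) * (k + 4)))%C by (unfold w; ring).
  field. repeat split; auto.
Qed.

Lemma half_laplacian_of_kernel_primitive (K L x : R) (q : C) : 0 < L ->
  let s := arccot (x / L) in
  has_kernel_primitive K s q ->
  is_half_laplacian (fun z => expi (K * arccot (z / L))) x
    (Ci * K * sin s / (L * PI) * (q - 2 * expi (K * s) * sin s * ln (cot (s / 2))))%C.
Proof.
intros hL s [Q [DQ [hQ [hD ->]]]].
exact (half_laplacian_of_primitive K L x Q DQ hL hQ hD).
Qed.

Lemma half_laplacian_finite (sg : R) (n : nat) (L x : R) : sg = 1 \/ sg = -1 -> 0 < L ->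
  let s := arccot (x / L) in let K := sg * (2 * INR n + 1) in
  is_half_laplacian (fun z => expi (K * arccot (z / L))) x
    (- (2 * Ci * sg / (L * PI * ((2 * INR n + 1)%R + 2)))
     - 2 * Ci * K / (L * PI) * expi (K * s)
       * ((cos s + sin s ^ 2 * ln (cot (s / 2)))%R + expi_sum sg s n))%C.
Proof.
intros hsg hL s K.
assert (h : has_kernel_primitive K s (finite_kernel_value sg s n)).
{ destruct (has_kernel_primitive_finite s n (proj1 (arccot_spec _))) as [_ h].
  unfold K. destruct hsg as [-> | ->]; [now rewrite Rmult_1_l|].
  apply has_kernel_primitive_conj in h. rewrite Cconj_finite_kernel_value in h.
  replace (-1 * (2 * INR n + 1)) with (- (2 * INR n + 1)) by ring. exact h. }
apply (half_laplacian_of_kernel_primitive K L x _ hL) in h. fold s in h.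
match type of h with is_half_laplacian _ _ ?v => match goal with |- is_half_laplacian _ _ ?w =>
  replace w with v; [exact h|] end end.
unfold finite_kernel_value. fold K.
assert (hK : 2 * INR n + 3 = 2 * INR n + 1 + 2) by ring. rewrite hK.
pose proof (pos_INR n).
assert (RtoC (2 * INR n + 1) <> 0%C) by (apply RtoC_neq_0; lra).
assert (h2 : ((2 * INR n + 1)%R + 2 <> 0)%C) by (rewrite <- RtoC_plus; apply RtoC_neq_0; lra).
assert (RtoC L <> 0%C) by (apply RtoC_neq_0; lra).
assert (RtoC PI <> 0%C) by (apply RtoC_neq_0; pose proof PI_RGT_0; lra).
assert (RtoC (sin s) <> 0%C) by (apply RtoC_neq_0; pose proof (sin_arccot_pos (x / L)); unfold s; lra).
replace (RtoC ((2 * INR n + 1) * (2 * INR n + 1 + 2)))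
  with ((2 * INR n + 1)%R * ((2 * INR n + 1)%R + 2))%C by (now rewrite <- RtoC_plus, <- RtoC_mult).
replace (RtoC (cos s + sin s ^ 2 * ln (cot (s / 2)))%R)
  with (cos s + sin s * sin s * ln (cot (s / 2)))%C
  by (rewrite <- !RtoC_mult, <- RtoC_plus; f_equal; ring).
set (E := expi (K * s)). unfold K. rewrite RtoC_mult.
field. repeat split; assumption.
Qed.

(** * Reduction of the hypergeometric series to three Lerch series *)

Lemma pochhammer_1 (n : nat) : pochhammer 1 n = INR (fact n).
Proof.
induction n as [|n IH]; [reflexivity|].
cbn [pochhammer]. rewrite IH, fact_simpl, mult_INR, S_INR, RtoC_mult, RtoC_plus. ring.
Qed.

(** Here c = b + 3, so the quotient of the Pochhammer symbols of b and c is rational in n with three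
    simple poles; the identity is stated without denominators. *)
Lemma pochhammer_shift (b : C) (n : nat) :
  (pochhammer b n * ((b + INR n) * (b + INR n + 1) * (b + INR n + 2))
   = b * (b + 1) * (b + 2) * pochhammer (b + 3) n)%C.
Proof.
induction n as [|n IH].
- cbn. ring.
- cbn [pochhammer]. rewrite S_INR, RtoC_plus.
  transitivity (pochhammer b n * ((b + INR n) * (b + INR n + 1) * (b + INR n + 2)) * (b + 3 + INR n))%C; [ring|].
  rewrite IH. ring.
Qed.

Lemma pochhammer_neq_0 (b : C) (n : nat) : (forall j : nat, b + INR j <> 0)%C -> pochhammer b n <> 0%C.
Proof.
intros h. induction n as [|n IH]; [exact C1_nz|].
now apply Cmult_neq_0.
Qed.

Lemma hyp2F1_unique (a b c z l : C) :
  is_series (V := C_NormedModule) (hyp2F1_term a b c z) l -> hyp2F1 a b c z = l.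
Proof.
intros h. unfold hyp2F1.
apply (iota_unique (V := C_CompleteNormedModule)); [|exact h].
intros y hy. exact (filterlim_locally_unique (V := C_NormedModule) _ _ _ hy h).
Qed.

(** The parameter a = 1 cancels n!, and with X = 2n - K the coefficient is K (4 - K^2) / ((X - 2) X
    (X + 2)). Then 1 / ((X - 2) X (X + 2)) = (1/(X - 2) - 2/X + 1/(X + 2)) / 8. The hypothesis on K
    keeps all these denominators and the Pochhammer symbol of c nonzero. *)
Lemma hyp2F1_lerch (K : R) (z Ta Tb Tc : C) :
  (forall j : Z, K + 2 * IZR j <> 0) ->
  is_lerch z (- K - 2) Ta -> is_lerch z (- K) Tb -> is_lerch z (- K + 2) Tc ->
  hyp2F1 1 (- K / 2 - 1)%R (- K / 2 + 2)%R z = (K * (4 - K * K) / 8 * (Ta - 2 * Tb + Tc))%C.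
Proof.
intros hK ha hb hc.
apply hyp2F1_unique.
pose proof (is_series_plus (V := C_NormedModule) _ _ _ _
  (is_series_plus (V := C_NormedModule) _ _ _ _ ha (is_series_scal (V := C_NormedModule) (- (2))%C _ _ hb)) hc) as h.
apply (is_series_scal (V := C_NormedModule) (K * (4 - K * K) / 8)%C) in h.
replace (K * (4 - K * K) / 8 * (Ta - 2 * Tb + Tc))%C
  with (K * (4 - K * K) / 8 * (Ta + (- (2)) * Tb + Tc))%C by ring.
revert h. apply is_series_ext. intros n.
change (@eq C
  (K * (4 - K * K) / 8 * (lerch_term z (- K - 2) n + (- (2)) * lerch_term z (- K) n + lerch_term z (- K + 2) n))%C
  (hyp2F1_term 1 (- K / 2 - 1)%R (- K / 2 + 2)%R z n)).
assert (hj : forall (j : nat) (i : Z), 2 * INR j - K + 2 * IZR i <> 0).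
{ intros j i e. apply (hK (- (Z.of_nat j + i))%Z).
  rewrite opp_IZR, plus_IZR, <- INR_IZR_INZ. lra. }
pose proof (hj n (-1)%Z) as h1. pose proof (hj n 0%Z) as h2. pose proof (hj n 1%Z) as h3.
assert (hc3 : (RtoC (- K / 2 + 2) = (- K / 2 - 1)%R + 3)%C) by (rewrite <- RtoC_plus; f_equal; field).
unfold hyp2F1_term. rewrite pochhammer_1, hc3.
set (b := RtoC (- K / 2 - 1)).
assert (hp : pochhammer (b + 3) n <> 0%C).
{ apply pochhammer_neq_0. intros j. unfold b. rewrite <- !RtoC_plus. apply RtoC_neq_0.
  pose proof (hj j 2%Z). lra. }
assert (hbn : (b + INR n = (2 * INR n - K - 2) / 2)%C).
{ unfold b. apply injective_projections; cbn; field. }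
assert (d1 : (2 * INR n - K - 2 <> 0)%C).
{ rewrite <- RtoC_mult, <- !RtoC_minus. apply RtoC_neq_0. lra. }
assert (d2 : (2 * INR n - K <> 0)%C).
{ rewrite <- RtoC_mult, <- !RtoC_minus. apply RtoC_neq_0. lra. }
assert (d3 : (2 * INR n - K + 2 <> 0)%C).
{ rewrite <- RtoC_mult, <- !RtoC_minus, <- RtoC_plus. apply RtoC_neq_0. lra. }
assert (hr : (pochhammer b n / pochhammer (b + 3) n
  = 8 * (b * (b + 1) * (b + 2)) / ((2 * INR n - K - 2) * (2 * INR n - K) * (2 * INR n - K + 2)))%C).
{ pose proof (pochhammer_shift b n) as hs.
  replace ((b + INR n) * (b + INR n + 1) * (b + INR n + 2))%C
    with ((2 * INR n - K - 2) * (2 * INR n - K) * (2 * INR n - K + 2) / 8)%C in hs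
    by (rewrite hbn; field).
  transitivity (8 * (pochhammer b n * ((2 * INR n - K - 2) * (2 * INR n - K) * (2 * INR n - K + 2) / 8))
    / ((2 * INR n - K - 2) * (2 * INR n - K) * (2 * INR n - K + 2)) / pochhammer (b + 3) n)%C.
  - field. repeat split; assumption.
  - rewrite hs. field. repeat split; assumption. }
transitivity (INR (fact n) * (pochhammer b n / pochhammer (b + 3) n) * (z ^ n / INR (fact n)))%C.
- rewrite hr. unfold lerch_term.
  replace (RtoC (2 * INR n + (- K - 2))) with (2 * INR n - K - 2)%C by (apply injective_projections; cbn; ring).
  replace (RtoC (2 * INR n + - K)) with (2 * INR n - K)%C by (apply injective_projections; cbn; ring).
  replace (RtoC (2 * INR n + (- K + 2))) with (2 * INR n - K + 2)%C by (apply injective_projections; cbn; ring).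
  replace b with ((- K) / 2 - 1)%C by (unfold b; apply injective_projections; cbn; field).
  assert (RtoC (INR (fact n)) <> 0%C) by (apply RtoC_neq_0, INR_fact_neq_0).
  field. repeat split; assumption.
- field. split; [apply RtoC_neq_0, INR_fact_neq_0 | exact hp].
Qed.

Lemma half_laplacian_hyp2F1 (m : Z) (L x : R) : 0 < L ->
  let s := arccot (x / L) in let K := IZR (2 * m + 1) in
  is_half_laplacian (fun z => expi (K * arccot (z / L))) x
    (- (2 * Ci / (L * PI * (K + 2)))
     - K / L * (sin s ^ 2)%R * expi (K * s)
     + 8 * Ci * hyp2F1 1 (- K / 2 - 1)%R (- K / 2 + 2)%R (expi (2 * s))
       / (L * PI * (4 - (K ^ 2)%R)))%C.
Proof.
intros hL s K.
destruct (lerch_invariant_odd s (proj1 (arccot_spec _)) m) as [_ [Ta [Tb [Tc [ha [hb [hc [_ [_ h]]]]]]]]].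
fold K in ha, hb, hc, h.
apply (half_laplacian_of_kernel_primitive K L x _ hL) in h. fold s in h.
match type of h with is_half_laplacian _ _ ?v => match goal with |- is_half_laplacian _ _ ?w =>
  replace w with v; [exact h|] end end.
rewrite (hyp2F1_lerch K _ Ta Tb Tc (IZR_odd_shift_neq_0 m) ha hb hc).
pose proof (IZR_odd_shift_neq_0 m 0) as k0. pose proof (IZR_odd_shift_neq_0 m 1) as k1.
pose proof (IZR_odd_shift_neq_0 m (-1)) as k2. fold K in k0, k1, k2.
assert (RtoC K <> 0%C) by (apply RtoC_neq_0; lra).
assert (h2 : (K + 2 <> 0)%C) by (rewrite <- RtoC_plus; apply RtoC_neq_0; lra).
assert (h4 : (4 - K * K <> 0)%C).
{ rewrite <- RtoC_mult, <- RtoC_minus. apply RtoC_neq_0. intros e.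
  assert (e' : (K + 2) * (K - 2) = 0) by lra. apply Rmult_integral in e'. lra. }
assert (RtoC L <> 0%C) by (apply RtoC_neq_0; lra).
assert (RtoC PI <> 0%C) by (apply RtoC_neq_0; pose proof PI_RGT_0; lra).
assert (hS : RtoC (sin s) <> 0%C) by (apply RtoC_neq_0; pose proof (sin_arccot_pos (x / L)); unfold s; lra).
unfold lerch_kernel_value.
rewrite !RtoC_pow. change (RtoC K ^ 2)%C with (K * (K * 1))%C.
replace (K * (K * 1))%C with (K * K)%C by ring.
set (e := expi (K * s)).
match goal with |- (_ * (?n / _ - _) = _)%C =>
  transitivity (Ci * K * n / (L * PI) - Ci * K * (sin s * sin s) / (L * PI) * (2 * e * ln (cot (s / 2))))%C end.
- field. repeat split; assumption.
(* [field] treats [Ci] as an indeterminate, so a multiple of Ci^2 + 1 = 0 is subtracted to turn the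
   product of the prefactor with the i PI term into a real coefficient. *)
- match goal with |- (?l = ?r)%C =>
    transitivity (l - (Ci * Ci + 1) * K * PI * (sin s * sin s) * e / (L * PI))%C end.
  + rewrite Ci_sqr. field. repeat split; assumption.
  + field. repeat split; assumption.
Qed.

(** * The formulas in the variable x *)

Lemma sqrt_1_plus_sqr_pos (x : R) : 0 < sqrt (1 + x ^ 2).
Proof. apply sqrt_lt_R0. nra. Qed.

Lemma sin_arccot (x : R) : sin (arccot x) = / sqrt (1 + x ^ 2).
Proof.
unfold arccot. rewrite sin_shift, cos_atan, Rsqr_pow2. unfold Rdiv. now rewrite Rmult_1_l.
Qed.

Lemma cos_arccot (x : R) : cos (arccot x) = x / sqrt (1 + x ^ 2).
Proof. unfold arccot. now rewrite cos_shift, sin_atan, Rsqr_pow2. Qed.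

Lemma polar_form (x : R) : (x + Ci = sqrt (1 + x ^ 2) * expi (arccot x))%C.
Proof.
pose proof (sqrt_1_plus_sqr_pos x).
apply injective_projections; cbn; rewrite sin_arccot, cos_arccot;
  change (x * (x * 1)) with (x ^ 2); field; lra.
Qed.

Lemma sqrt_pow_Rpower (y : R) (n : nat) : 0 < y -> sqrt y ^ n = Rpower y (INR n / 2).
Proof.
intros hy. rewrite <- Rpower_sqrt by exact hy.
rewrite <- Rpower_pow by apply exp_pos. rewrite Rpower_mult. f_equal. field.
Qed.

Lemma Rpower_neq_0 (y a : R) : RtoC (Rpower y a) <> 0%C.
Proof. apply RtoC_neq_0. pose proof (exp_pos (a * ln y)). unfold Rpower. lra. Qed.

Lemma Cpow_Z_polar (x : R) (m : Z) :
  Cpow_Z (x + Ci) m = (Rpower (1 + x ^ 2) (IZR m / 2) * expi (IZR m * arccot x))%C.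
Proof.
assert (hx : 0 < 1 + x ^ 2) by nra.
assert (H : forall n : nat, ((x + Ci) ^ n = Rpower (1 + x ^ 2) (INR n / 2) * expi (INR n * arccot x))%C).
{ intros n. rewrite polar_form, Cpow_mult_l, expi_pow, <- RtoC_pow, sqrt_pow_Rpower by exact hx. reflexivity. }
destruct m as [|p|p]; cbn [Cpow_Z].
- unfold Rdiv. rewrite !Rmult_0_l, Rpower_O, expi_0 by exact hx. ring.
- rewrite H, INR_IZR_INZ, positive_nat_Z. reflexivity.
- rewrite H, INR_IZR_INZ, positive_nat_Z.
  change (IZR (Z.neg p)) with (- IZR (Z.pos p)).
  replace (- IZR (Z.pos p) / 2) with (- (IZR (Z.pos p) / 2)) by field.
  rewrite Ropp_mult_distr_l_reverse, expi_opp, Rpower_Ropp, RtoC_inv.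
  + field. split; [apply expi_neq_0 | apply Rpower_neq_0].
  + pose proof (exp_pos (IZR (Z.pos p) / 2 * ln (1 + x ^ 2))). unfold Rpower. lra.
Qed.

Lemma cayley_pow_expi (k : Z) (x : R) : cayley_pow k x = expi (IZR k * arccot x).
Proof.
unfold cayley_pow. rewrite Cpow_Z_polar. field. apply Rpower_neq_0.
Qed.

(** By the half-angle formula cot (a/2) = (1 + cos a) / sin a, which is x + sqrt (1 + x^2) at a =
    arccot x. *)
Lemma ln_cot_half_arccot (x : R) : ln (cot (arccot x / 2)) = arcsinh x.
Proof.
unfold arcsinh. f_equal.
pose proof (sqrt_1_plus_sqr_pos x) as hr.
assert (E : cot (arccot x / 2) = (1 + cos (arccot x)) / sin (arccot x)).
{ destruct (arccot_spec x) as [h _].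
  assert (0 < sin (arccot x / 2)) by (apply sin_gt_0; lra).
  assert (0 < cos (arccot x / 2)) by (apply cos_gt_0; lra).
  replace (arccot x) with (2 * (arccot x / 2)) at 2 3 by field.
  rewrite cos_2a_cos, sin_2a. unfold cot. field. lra. }
rewrite E, sin_arccot, cos_arccot.
replace (x ^ 2 + 1) with (1 + x ^ 2) by ring. field. lra.
Qed.

Lemma sum_n_Cmult (c : C) (f g : nat -> C) (N : nat) :
  (forall n, f n = c * g n)%C -> sum_n f N = (c * sum_n g N)%C.
Proof.
intros h. induction N as [|N IH]; [rewrite !sum_O; apply h|].
rewrite !sum_Sn, IH, h. change plus with Cplus. symmetry. apply Cmult_plus_distr_l.
Qed.

Lemma odd_sgn_abs (k : Z) : Z.Odd k ->
  let n := Z.to_nat ((Z.abs k - 1) / 2) in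
  (IZR (Z.sgn k) = 1 \/ IZR (Z.sgn k) = -1) /\
  IZR (Z.abs k) = 2 * INR n + 1 /\ IZR k = IZR (Z.sgn k) * (2 * INR n + 1).
Proof.
intros [m hm] n.
assert (habs : Z.abs k = (2 * Z.of_nat n + 1)%Z).
{ unfold n. rewrite Z2Nat.id by (apply Z.div_pos; lia).
  pose proof (Z_div_mod_eq_full (Z.abs k - 1) 2).
  pose proof (Z.mod_pos_bound (Z.abs k - 1) 2). lia. }
assert (hR : IZR (Z.abs k) = 2 * INR n + 1)
  by (rewrite habs, plus_IZR, mult_IZR, <- INR_IZR_INZ; reflexivity).
split; [|split; [exact hR|]].
- destruct (Z.lt_trichotomy k 0) as [h | [h | h]]; [right | lia | left].
  + now rewrite Z.sgn_neg.
  + now rewrite Z.sgn_pos.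
- rewrite <- hR, <- mult_IZR. f_equal. rewrite Z.mul_comm. symmetry. apply Z.abs_sgn.
Qed.

Theorem theorem2p4 (k : Z) (hk : Z.Odd k) :
  let K := IZR k in
  let sgk := IZR (Z.sgn k) in
  let absk := IZR (Z.abs k) in
  let N := Z.to_nat ((Z.abs k - 1) / 2) in
  (forall (L s : R), 0 < L -> 0 < s < PI ->
     is_half_laplacian_s L (fun t : R => expi (K * t)) s
       (- (2 * Ci / (L * PI * (K + 2)))
        - K / L * (sin s ^ 2)%R * expi (K * s)
        + 8 * Ci * hyp2F1 1 (- K / 2 - 1)%R (- K / 2 + 2)%R (expi (2 * s))
          / (L * PI * (4 - (K ^ 2)%R)))%C /\
     is_half_laplacian_s L (fun t : R => expi (K * t)) s
       (- (2 * Ci * sgk / (L * PI * (absk + 2)))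
        - 2 * Ci * K / (L * PI) * expi (K * s) *
          ((cos s + sin s ^ 2 * ln (cot (s / 2)))%R
           + sum_n (fun n : nat =>
               4 * expi (- sgk * (2 * INR n + 1) * s)
               / ((2 * INR n - 1) * (2 * INR n + 1) * (2 * INR n + 3))%R) N))%C)
  /\
  (forall x : R,
     is_half_laplacian (cayley_pow k) x
       (- (2 * Ci / (PI * (K + 2)))
        - K * Cpow_Z (x + Ci) k / Rpower (1 + x ^ 2) (K / 2 + 1)
        + 8 * Ci / (PI * (4 - (K ^ 2)%R))
          * hyp2F1 1 (- K / 2 - 1)%R (- K / 2 + 2)%R
              ((x + Ci) ^ 2 / (1 + x ^ 2)%R))%C /\
     is_half_laplacian (cayley_pow k) x
       (- (2 * Ci * sgk / (PI * (absk + 2)))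
        - 2 * Ci * K * Cpow_Z (x + Ci) k
          * (x * sqrt (1 + x ^ 2) + arcsinh x)%R
          / (PI * Rpower (1 + x ^ 2) (K / 2 + 1))
        - sum_n (fun n : nat =>
            let m := (k - Z.sgn k * (2 * Z.of_nat n + 1))%Z in
            8 * Ci * K * Cpow_Z (x + Ci) m
            / (PI * ((2 * INR n - 1) * (2 * INR n + 1) * (2 * INR n + 3))%R
               * Rpower (1 + x ^ 2) (IZR m / 2))) N)%C).
Proof.
intros K sgk absk N.
destruct (odd_sgn_abs k hk) as [hsg [habs hK]]. fold K sgk absk N in hsg, habs, hK.
assert (P1 : forall L x, 0 < L ->
  let s := arccot (x / L) in
  is_half_laplacian (fun z => expi (K * arccot (z / L))) x
    (- (2 * Ci / (L * PI * (K + 2)))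
     - K / L * (sin s ^ 2)%R * expi (K * s)
     + 8 * Ci * hyp2F1 1 (- K / 2 - 1)%R (- K / 2 + 2)%R (expi (2 * s))
       / (L * PI * (4 - (K ^ 2)%R)))%C).
{ intros L x hL. destruct hk as [m hm]. unfold K. rewrite hm. now apply half_laplacian_hyp2F1. }
assert (P2 : forall L x, 0 < L ->
  let s := arccot (x / L) in
  is_half_laplacian (fun z => expi (K * arccot (z / L))) x
    (- (2 * Ci * sgk / (L * PI * (absk + 2)))
     - 2 * Ci * K / (L * PI) * expi (K * s)
       * ((cos s + sin s ^ 2 * ln (cot (s / 2)))%R + expi_sum sgk s N))%C).
{ intros L x hL. rewrite hK, habs. now apply half_laplacian_finite. }
split.
- intros L s hL hs.
  assert (e : arccot (L * cot s / L) = s).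
  { replace (L * cot s / L) with (cot s) by (field; lra). now apply arccot_cot. }
  split; [specialize (P1 L (L * cot s) hL) | specialize (P2 L (L * cot s) hL)]; cbv zeta in *;
    rewrite e in *; assumption.
- intros x.
  assert (hx : 0 < 1 + x ^ 2) by nra.
  assert (hC : RtoC (1 + x ^ 2) <> 0%C) by (apply RtoC_neq_0; lra).
  assert (hPI : RtoC PI <> 0%C) by (apply RtoC_neq_0; pose proof PI_RGT_0; lra).
  assert (hfun : (fun z => expi (K * arccot (z / 1))) = cayley_pow k).
  { apply functional_extensionality. intros z. rewrite Rdiv_1_r. symmetry. apply cayley_pow_expi. }
  specialize (P1 1 x Rlt_0_1). specialize (P2 1 x Rlt_0_1). cbv zeta in P1, P2.
  rewrite hfun, Rdiv_1_r in P1, P2.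
  assert (hpow : (Cpow_Z (x + Ci) k / Rpower (1 + x ^ 2) (K / 2 + 1)
    = (sin (arccot x) ^ 2)%R * expi (K * arccot x))%C).
  { rewrite Cpow_Z_polar, Rpower_plus, Rpower_1 by exact hx. fold K.
    rewrite sin_arccot, pow_inv, pow2_sqrt, RtoC_inv, RtoC_mult by
      (try apply Rgt_not_eq; try apply sqrt_1_plus_sqr_pos; lra).
    field. split; [exact hC | apply Rpower_neq_0]. }
  split.
  + match type of P1 with is_half_laplacian _ _ ?v => match goal with |- is_half_laplacian _ _ ?w =>
      replace w with v; [exact P1|] end end.
    assert (hz : ((x + Ci) ^ 2 / (1 + x ^ 2)%R = expi (2 * arccot x))%C).
    { change ((x + Ci) ^ 2)%C with (Cpow_Z (x + Ci) 2).
      rewrite Cpow_Z_polar. replace (2 / 2) with 1 by field. rewrite Rpower_1 by exact hx.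
      field. exact hC. }
    rewrite hz.
    replace (K * Cpow_Z (x + Ci) k / Rpower (1 + x ^ 2) (K / 2 + 1))%C
      with (K * (Cpow_Z (x + Ci) k / Rpower (1 + x ^ 2) (K / 2 + 1)))%C
      by (unfold Cdiv; ring).
    rewrite hpow. rewrite !Cmult_1_l.
    unfold Cdiv. replace (/ 1)%C with (RtoC 1) by (apply injective_projections; cbn; field).
    ring.
  + match type of P2 with is_half_laplacian _ _ ?v => match goal with |- is_half_laplacian _ _ ?w =>
      replace w with v; [exact P2|] end end.
    rewrite !Cmult_1_l.
    rewrite (sum_n_Cmult (2 * Ci * K / PI * expi (K * arccot x))%C _
      (fun n : nat => 4 * expi (- sgk * (2 * INR n + 1) * arccot x)
        / ((2 * INR n - 1) * (2 * INR n + 1) * (2 * INR n + 3))%R)%C).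
    2:{ intros n. cbv zeta. rewrite Cpow_Z_polar.
      set (m := (k - Z.sgn k * (2 * Z.of_nat n + 1))%Z).
      assert (em : IZR m = K - sgk * (2 * INR n + 1)).
      { unfold m. now rewrite minus_IZR, mult_IZR, plus_IZR, mult_IZR, <- INR_IZR_INZ. }
      assert (ee : expi (IZR m * arccot x) = (expi (K * arccot x) * expi (- sgk * (2 * INR n + 1) * arccot x))%C).
      { rewrite <- expi_plus, em. f_equal. ring. }
      rewrite ee.
      (* Parity is used instead of positivity because 2n - 1 is negative at n = 0. *)
      pose proof (IZR_odd_shift_neq_0 (Z.of_nat n) 0) as h0.
      pose proof (IZR_odd_shift_neq_0 (Z.of_nat n) 1) as h1.
      pose proof (IZR_odd_shift_neq_0 (Z.of_nat n) (-1)) as h2.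
      rewrite plus_IZR, mult_IZR, <- INR_IZR_INZ in h0, h1, h2.
      assert (hd : RtoC ((2 * INR n - 1) * (2 * INR n + 1) * (2 * INR n + 3)) <> 0%C).
      { apply RtoC_neq_0. repeat apply Rmult_integral_contrapositive_currified; lra. }
      pose proof (Rpower_neq_0 (1 + x ^ 2) (IZR m / 2)).
      field. repeat split; assumption. }
    fold (expi_sum sgk (arccot x) N).
    rewrite ln_cot_half_arccot.
    replace (2 * Ci * K * Cpow_Z (x + Ci) k * (x * sqrt (1 + x ^ 2) + arcsinh x)%R
          / (PI * Rpower (1 + x ^ 2) (K / 2 + 1)))%C
      with (2 * Ci * K / PI * (Cpow_Z (x + Ci) k / Rpower (1 + x ^ 2) (K / 2 + 1))
        * (x * sqrt (1 + x ^ 2) + arcsinh x)%R)%C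
      by (field; split; [apply Rpower_neq_0 | exact hPI]).
    rewrite hpow.
    assert (ec : cos (arccot x) + sin (arccot x) ^ 2 * arcsinh x
      = sin (arccot x) ^ 2 * (x * sqrt (1 + x ^ 2) + arcsinh x)).
    { rewrite sin_arccot, cos_arccot. pose proof (sqrt_1_plus_sqr_pos x). field. lra. }
    rewrite ec, RtoC_mult. unfold Cdiv. ring.
Qed.
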